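(* Let $n\ge2$ and $k\in\{1,\dots,n-1\}$. With the $U$-action $u.(M,t)=(u|_{\lambda=(-1)^{k-1}t}\cdot M,\,t)$ on $\mathcal X_k$, the pair $(\mathcal X_k,g)$ is a unipotent crystal. Moreover, the geometric crystal it induces (i.e. with $\gamma(v)=(X_{11},\dots,X_{nn})$, $\varphi_i(v)=X_{i+1,i}/X_{ii}$, $\varepsilon_i(v)=X_{i+1,i}/X_{i+1,i+1}$ for $X$ the unfolding of $g(v)$, and $e_i^c(v)=\hat x_i(\frac{c-1}{\varphi_i(v)}).v$) coincides with $(\mathcal X_k,\gamma,\varphi_i,\varepsilon_i,e_i)$ as defined below.
   Context: Notation: $[i,j]=\{m\in\mathbb Z:i\le m\le j\}$, $[n]=[1,n]$, $E_{ij}$ matrix units. $\mathcal X_k=\mathrm{Gr}(k,n)\times\mathbb C^\times$; points of $\mathrm{Gr}(k,n)$ are column spans of full-rank $n\times k$ matrices, $P_J(M)$ is the maximal minor on rows $J$ (increasing order); for a finite set $I$ of integers $P_I(M)=P_{I'}(M)$ with $I'$ the residues mod $n$ in $[n]$, and $P_{I'}=0$ if $|I'|\ne k$. $\mathrm{GL}_n(\mathbb C)$ acts by left multiplication. Loop group objects: $G$ is the monoid of $n\times n$ matrices over $\mathbb C[\lambda,\lambda^{-1}]$ with nonzero Laurent polynomial determinant. Unfolding of $A$ with $A_{ij}=\sum_m a^{ij}_m\lambda^m$: $X_{rn+i,sn+j}=a^{ij}_{r-s}$ ($r,s\in\mathbb Z$, $i,j\in[n]$). $B^-\subset G$: unfolding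 lower triangular with nonzero diagonal. $\hat x_i(a)=\mathrm{Id}+aE_{i,i+1}$ ($i\in[n-1]$), $\hat x_0(a)=\mathrm{Id}+a\lambda^{-1}E_{n1}$; $U$ is the group they generate; $u|_{\lambda=z}$ denotes evaluation of $\lambda$ at $z$. Pseudo-rational $U$-action on $V$: partial map $(u,v)\mapsto u.v$ with $1.v=v$, $(u'u).v=u'.(u.v)$ whenever the right side is defined, and $(a,v)\mapsto\hat x_i(a).v$ rational for each $i$. On $B^-$: $u.b=b'$ if $ub=b'u'$ with $b'\in B^-$, $u'\in U$. A unipotent crystal is $(V,g)$ with $V$ an irreducible (ind-)variety with pseudo-rational $U$-action and $g:V\to B^-$ a rational map commuting with the $U$-actions where defined, such that $v\mapsto g(v)_{i+1,i}$ (unfolded) is not identically zero for each $i\in\mathbb Z/n\mathbb Z$. The map $g:\mathcal X_k\to B^-$: $g(M,t)=A$ with $A_{ij}=c_{ij}\frac{P_{[j-k+1,j-1]\cup\{i\}}(M)}{P_{[j-k,j-1]}(M)}$, where $c_{ij}=1$ if $j\le k$, $c_{ij}=t$ if $j>k$ and $i\ge j$, $c_{ij}=\lambda$ if $j>k$ and $i<j$. The geometric crystal maps on $\mathcal X_k$ ($i\in\mathbb Z/n\mathbb Z$ represented in $\{0,\dots,n-1\}$, $\delta_{i,a}=1$ iff $i\equiv a$ mod $n$): $\gamma_i=P_{[i-k+1,i]}/P_{[i-k,i-1]}$ for $1\le i\le k$, $\gamma_i=t\,P_{[i-k+1,i]}/P_{[i-k,i-1]}$ for $k<i\le n$; $\varphi_i=t^{-\delta_{i,0}}P_{[i-k+1,i-1]\cup\{i+1\}}/P_{[i-k+1,i]}$;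 $\varepsilon_i=t^{-\delta_{i,k}}\frac{P_{[i-k+1,i-1]\cup\{i+1\}}P_{[i-k+1,i]}}{P_{[i-k,i-1]}P_{[i-k+2,i+1]}}$; $e_i^c(M,t)=(x_i(\frac{c-1}{\varphi_i(M,t)})\cdot M,t)$ for $i\ne0$ and $e_0^c(M,t)=(x_0(\frac{(-1)^{k-1}}{t}\frac{c-1}{\varphi_0(M,t)})\cdot M,t)$, where $x_i(a)=\mathrm{Id}+aE_{i,i+1}$, $x_0(a)=\mathrm{Id}+aE_{n1}$. *)

(* Defs.v *)
From HB Require Import structures.
From mathcomp Require Import all_boot all_order all_algebra.
From mathcomp Require Import fraction.
From mathcomp Require Import boolp classical_sets reals complex.
From mathcomp Require Import mpoly.

Set Implicit Arguments.
Unset Strict Implicit.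
Unset Printing Implicit Defensive.

Import Order.TTheory GRing.Theory Num.Theory.
Local Open Scope classical_set_scope.
Local Open Scope ring_scope.

(* Partial maps; [pval f x] is meaningful only when [pdom f x] holds. *)
Record pmap (X Y : Type) := PMap {pdom : set X; pval :> X -> Y}.

Section Varieties.
Variable K : fieldType.

(* A set with a finite atlas of affine charts, as in Weil's abstract varieties. *)
(* All the axioms are in [variety]; over an algebraically closed field K these  *)
(* are the (classical, reduced, separated) algebraic varieties over K.          *)
Record charted := Charted {
  point :> Type;
  chart : finType;
  cdim : chart -> nat;
  cdom : chart -> set point;
  coord : forall i : chart, point -> 'rV[K]_(cdim i) }.

Definition algebraic m (Z : set 'rV[K]_m) : Prop :=
  exists S : set {mpoly K[m]},
    Z = [set x | forall p, S p -> p.@[x ord0] = 0].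

Definition zopen (X : charted) (O : set X) : Prop :=
  forall i : chart X, exists S : set {mpoly K[cdim i]},
    forall x, cdom i x ->
      (O x <-> exists2 p, S p & p.@[coord i x ord0] != 0).

Definition zdense (X : charted) (D : set X) : Prop :=
  forall O : set X, zopen O -> O !=set0 -> (O `&` D) !=set0.

(* Near x, and inside D, the map f is given in suitable charts by quotients of *)
(* polynomials; in particular D is a neighbourhood of x.                       *)
Definition regular_at (X Y : charted) (D : set X) (f : X -> Y) (x : X) : Prop :=
  exists (i : chart X) (j : chart Y)
    (p : 'I_(cdim j) -> {mpoly K[cdim i]}) (q : {mpoly K[cdim i]}),
    [/\ cdom i x, q.@[coord i x ord0] != 0 &
      forall y, cdom i y -> q.@[coord i y ord0] != 0 ->
        [/\ D y, cdom j (f y) &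
          forall l, coord j (f y) ord0 l
                    = (p l).@[coord i y ord0] / q.@[coord i y ord0]]].

Definition variety (X : charted) : Prop :=
  [/\ forall x : X, exists i, cdom i x,
      forall i : chart X, {in cdom i &, injective (@coord X i)},
      forall i : chart X, algebraic (@coord X i @` cdom i),
      (* the charts are open, and the changes of charts are regular *)
      forall i j : chart X, exists2 S : set {mpoly K[cdim i]},
        forall x, cdom i x ->
          (cdom j x <-> exists2 p, S p & p.@[coord i x ord0] != 0) &
        forall x, cdom i x -> cdom j x ->
          exists (p : 'I_(cdim j) -> {mpoly K[cdim i]}) (q : {mpoly K[cdim i]}),
          q.@[coord i x ord0] != 0 /\
          forall y, cdom i y -> cdom j y -> q.@[coord i y ord0] != 0 ->
          forall l, coord j y ord0 l
                    = (p l).@[coord i y ord0] / q.@[coord i y ord0] &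
      (* the diagonal is closed *)
      forall i j : chart X,
        algebraic [set row_mx (coord i x) (coord j x)
                  | x in cdom i `&` cdom j]].

Definition irreducible (X : charted) : Prop :=
  [set: X] !=set0 /\
  forall O O' : set X, zopen O -> zopen O' -> O !=set0 -> O' !=set0 ->
    (O `&` O') !=set0.

Definition rational (X Y : charted) (f : pmap X Y) : Prop :=
  zdense (pdom f) /\ forall x, pdom f x -> regular_at (pdom f) f x.

Definition eq_rational (X : charted) (T : Type) (f h : pmap X T) : Prop :=
  [/\ zopen (pdom f `&` pdom h), zdense (pdom f `&` pdom h) &
      forall x, pdom f x -> pdom h x -> f x = h x].

Definition prodV (X Y : charted) : charted :=
  @Charted (X * Y)%type (chart X * chart Y)%type
    (fun i => cdim i.1 + cdim i.2)%N
    (fun i x => cdom i.1 x.1 /\ cdom i.2 x.2)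
    (fun i x => row_mx (coord i.1 x.1) (coord i.2 x.2)).

Definition affine_line : charted :=
  @Charted K unit (fun=> 1%N) (fun=> setT) (fun _ c => c%:M).

(* K^* as the hyperbola xy = 1. *)
Definition Gm : charted :=
  @Charted {c : K | c != 0} unit (fun=> (1 + 1)%N) (fun=> setT)
    (fun _ c => row_mx (val c)%:M (val c)^-1%:M).

End Varieties.

Section LoopGroup.
Variable K : fieldType.

(* K[lambda, lambda^-1] is the subring of fractions p / lambda^d of K(lambda). *)
Definition ratfun : fieldType := {fraction {poly K}}.
Definition scal (c : K) : ratfun := tofrac c%:P.
Definition lambda : ratfun := tofrac 'X.

Definition lfrac (pd : {poly K} * nat) : ratfun :=
  tofrac pd.1 / lambda ^+ pd.2.

Definition laurent (f : ratfun) : Prop := exists pd, f = lfrac pd.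

Definition lrep (f : ratfun) : {poly K} * nat :=
  xget (0, 0%N) [set pd | f = lfrac pd].

(* Coefficient of lambda^m, and value at z, of a Laurent polynomial; see *)
(* [lcoef_lfrac] and [leval_lfrac].                                      *)
Definition lcoef (f : ratfun) (m : int) : K :=
  if m + (lrep f).2%:Z is Posz l then (lrep f).1`_l else 0.

Definition leval (z : K) (f : ratfun) : K := (lrep f).1.[z] / z ^+ (lrep f).2.

Lemma lfrac_eq p d p' d' :
  lfrac (p, d) = lfrac (p', d') -> p * 'X^d' = p' * 'X^d.
Proof.
rewrite /lfrac /lambda /= -!rmorphXn /=.
have nzX e : tofrac ('X^e : {poly K}) != 0.
  by rewrite tofrac_eq0 expf_neq0 ?polyX_eq0.
move/eqP; rewrite eqr_div // -!rmorphM /=.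
by rewrite tofrac_eq => /eqP.
Qed.

Lemma lrepP p d : (lrep (lfrac (p, d))).1 * 'X^d = p * 'X^((lrep (lfrac (p, d))).2).
Proof.
rewrite /lrep; case: xgetP => [[p' d'] _ /= /lfrac_eq <- //|].
by move/(_ (p, d)); case.
Qed.

Lemma lcoef_lfrac p d m :
  lcoef (lfrac (p, d)) m = if m + d%:Z is Posz l then p`_l else 0.
Proof.
rewrite /lcoef; have := lrepP p d; case: (lrep _) => p' d' /= E.
have C l : (if (l < d)%N then 0 else p'`_(l - d)) =
           (if (l < d')%N then 0 else p`_(l - d')).
  by rewrite -!coefMXn E.
case E1: (m + d'%:Z) => [l|l]; case E2: (m + d%:Z) => [l2|l2] //.
- have := C (l + d)%N; rewrite ltnNge leq_addl addnK /= => ->.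
  have -> : (l + d = l2 + d')%N.
    by apply/eqP; rewrite -eqz_nat !PoszD -E1 -E2 addrAC.
  by rewrite ltnNge leq_addl addnK.
- have := C (l + d)%N; rewrite ltnNge leq_addl addnK /= => ->.
  case: ltnP => // le_d; exfalso.
  have : (l + d)%N%:Z < d'%:Z.
    by rewrite PoszD -E1 addrAC E2 NegzE gtrDr oppr_lt0.
  by rewrite ltz_nat ltnNge le_d.
- have := C (l2 + d')%N; rewrite [in RHS]ltnNge leq_addl addnK /= => <-.
  case: ltnP => // le_d; exfalso.
  have : (l2 + d')%N%:Z < d%:Z.
    by rewrite PoszD -E2 addrAC E1 NegzE gtrDr oppr_lt0.
  by rewrite ltz_nat ltnNge le_d.
Qed.

Lemma leval_lfrac z p d : z != 0 -> leval z (lfrac (p, d)) = p.[z] / z ^+ d.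
Proof.
move=> nz; rewrite /leval; have := lrepP p d.
case: (lrep _) => p' d' /= /(congr1 (horner^~ z)).
rewrite !hornerM !hornerXn => E; apply/eqP.
by rewrite eqr_div ?expf_neq0 // E.
Qed.

Variable n : nat.

Definition inG (A : 'M[ratfun]_n) : Prop :=
  (forall i j, laurent (A i j)) /\ \det A != 0.

(* The bounded sums pick the row and the column of the residues of p, q in [n]; *)
(* [unfoldingE] is the defining formula.                                        *)
Definition unfolding (A : 'M[ratfun]_n) (p q : int) : K :=
  \sum_(i < n | i%:Z == ((p - 1) %% n)%Z)
    \sum_(j < n | j%:Z == ((q - 1) %% n)%Z)
      lcoef (A i j) (((p - 1) %/ n)%Z - ((q - 1) %/ n)%Z).

Lemma unfoldingE A (r s : int) (i j : 'I_n) :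
  unfolding A (r * n%:Z + i.+1%:Z) (s * n%:Z + j.+1%:Z) = lcoef (A i j) (r - s).
Proof.
have E (c : int) (l : 'I_n) :
  (((c * n%:Z + l.+1%:Z - 1) %% n)%Z = l) * (((c * n%:Z + l.+1%:Z - 1) %/ n)%Z = c).
  have n0 : n%:Z != 0 by rewrite eqz_nat -lt0n (leq_ltn_trans _ (ltn_ord l)).
  rewrite intS [1 + _]addrC addrA addrK.
  split; first by rewrite modzMDl modz_small // ltz_nat ltn_ord.
  by rewrite divzMDl // divz_small ?addr0 // ltz_nat ltn_ord.
rewrite /unfolding !E (big_pred1 i) => [|l]; last by rewrite eqz_nat.
by rewrite (big_pred1 j) // => l; rewrite eqz_nat.
Qed.

Definition inBminus (A : 'M[ratfun]_n) : Prop :=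
  [/\ inG A, forall p q : int, p < q -> unfolding A p q = 0 &
      forall p : int, unfolding A p p != 0].

(* Matrix unit E_{ij}, with i and j counted from 1. *)
Definition Emx (T : pzRingType) (i j : nat) : 'M[T]_n :=
  \matrix_(a, b) ((a.+1 == i) && (b.+1 == j))%:R.

Definition xhat (i : 'I_n) (a : K) : 'M[ratfun]_n :=
  1%:M + if val i == 0%N then (scal a / lambda) *: Emx _ n 1
         else scal a *: Emx _ i i.+1.

Inductive inU : 'M[ratfun]_n -> Prop :=
| inU_gen i a : inU (xhat i a)
| inU_one : inU 1%:M
| inU_mul u u' : inU u -> inU u' -> inU (u *m u')
| inU_inv u : inU u -> inU (invmx u).

(* b' = u.b for the partial action of U on B^-. *)
Definition Bact (u b b' : 'M[ratfun]_n) : Prop :=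
  inBminus b' /\ exists2 u', inU u' & u *m b = b' *m u'.

Definition pseudo_rational (V : charted K)
    (act : 'M[ratfun]_n -> pmap V V) : Prop :=
  [/\ forall v, pdom (act 1%:M) v /\ act 1%:M v = v,
      forall u u' v, inU u -> inU u' ->
        pdom (act u) v -> pdom (act u') (act u v) ->
        pdom (act (u' *m u)) v /\ act (u' *m u) v = act u' (act u v) &
      forall i : 'I_n,
        rational (X := prodV (affine_line K) V)
          (PMap (fun av => pdom (act (xhat i av.1)) av.2)
                (fun av => act (xhat i av.1) av.2))].

(* B^- is the increasing union, over N, of the quasi-affine varieties of those  *)
(* of its elements with Laurent coefficients only in degrees [-N, N], which are *)
(* their coordinates; a rational map to B^- lands in one of these.              *)
Definition rational_Bminus (V : charted K) (g : pmap V 'M[ratfun]_n) : Prop :=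
  [/\ forall v, pdom g v -> inBminus (g v),
      exists N : nat, forall v, pdom g v -> forall i j (m : int),
        N%:Z < `|m| -> lcoef (g v i j) m = 0 &
      forall i j (m : int),
        rational (Y := affine_line K)
          (PMap (pdom g) (fun v => lcoef (g v i j) m))].

Definition unipotent_crystal (V : charted K)
    (act : 'M[ratfun]_n -> pmap V V) (g : pmap V 'M[ratfun]_n) : Prop :=
  [/\ variety V /\ irreducible V,
      pseudo_rational act,
      rational_Bminus g,
      forall u v b', inU u -> pdom (act u) v -> pdom g v ->
        pdom g (act u v) -> Bact u (g v) b' -> g (act u v) = b' &
      forall i : 'I_n, exists2 v, pdom g v & unfolding (g v) (i%:Z + 1) i != 0].

(* The maps of a geometric crystal; the index i : 'I_n stands for i mod n, *)
(* while the j-th entry of gamma is counted from 1.                        *)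
Record crystal_maps (V : charted K) := CrystalMaps {
  cgamma : pmap V 'rV[K]_n;
  cphi : 'I_n -> pmap V K;
  ceps : 'I_n -> pmap V K;
  ce : 'I_n -> pmap (prodV (Gm K) V) V }.

Definition eq_crystal (V : charted K) (c c' : crystal_maps V) : Prop :=
  [/\ eq_rational (cgamma c) (cgamma c'),
      forall i, eq_rational (cphi c i) (cphi c' i),
      forall i, eq_rational (ceps c i) (ceps c' i) &
      forall i, eq_rational (ce c i) (ce c' i)].

Definition induced_phi (V : charted K) (g : pmap V 'M[ratfun]_n)
    (i : 'I_n) (v : V) : K :=
  unfolding (g v) (i%:Z + 1) i / unfolding (g v) i i.

Definition induced_crystal (V : charted K)
    (act : 'M[ratfun]_n -> pmap V V) (g : pmap V 'M[ratfun]_n) :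
    crystal_maps V :=
  CrystalMaps
    (PMap (pdom g) (fun v => \row_(j < n) unfolding (g v) j.+1 j.+1))
    (fun i => PMap (pdom g) (induced_phi g i))
    (fun i => PMap (pdom g) (fun v =>
       unfolding (g v) (i%:Z + 1) i / unfolding (g v) (i%:Z + 1) (i%:Z + 1)))
    (fun i =>
       let u (cv : prodV (Gm K) V) :=
         xhat i ((val cv.1 - 1) / induced_phi g i cv.2) in
       PMap (fun cv => [/\ pdom g cv.2, induced_phi g i cv.2 != 0 &
                           pdom (act (u cv)) cv.2])
            (fun cv => act (u cv) cv.2)).

End LoopGroup.

Section Grassmannian.
Variables (K : fieldType) (n k : nat).

Definition grass := {W : {vspace 'cV[K]_n} | \dim W == k}.

(* An n x k matrix with column span W; see [colspan_grmx]. *)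
Definition grmx (W : grass) : 'M[K]_(n, k) :=
  \matrix_(i, j) (vbasis (val W))`_j i ord0.

Lemma colspan_grmx W : (<<[seq col j (grmx W) | j <- enum 'I_k]>>)%VS = val W.
Proof.
case: W => W /= dW; rewrite -[RHS](span_basis (vbasisP W)); congr span.
apply: (@eq_from_nth _ 0) => [|l].
  by rewrite size_map size_enum_ord size_tuple (eqP dW).
rewrite size_map size_enum_ord => lk.
rewrite (nth_map (Ordinal lk)) ?size_enum_ord //.
by apply/colP=> a; rewrite !mxE /= nth_enum_ord.
Qed.

(* The square submatrix on the rows of J, in increasing order. *)
Definition rows (J : {set 'I_n}) (M : 'M[K]_(n, k)) : 'M[K]_k :=
  match #|J| =P k with
  | ReflectT e => rowsub (fun a => enum_val (cast_ord (esym e) a)) M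
  | ReflectF _ => 0
  end.

Definition minor (J : {set 'I_n}) (M : 'M[K]_(n, k)) : K :=
  if #|J| == k then \det (rows J M) else 0.

(* Residues mod n in [n] = {1, ..., n}, the ordinal a standing for a + 1. *)
Definition residues (I : seq int) : {set 'I_n} :=
  [set a : 'I_n | has (fun m => (m == a.+1%:Z %[mod n])%Z) I].

(* Plucker coordinates of the chosen representative: only expressions *)
(* homogeneous of degree 0 in these are meaningful.                   *)
Definition pluck (I : seq int) (W : grass) : K := minor (residues I) (grmx W).

(* The chart P_J != 0: W is the column span of a unique matrix with rows J *)
(* equal to the identity, whose entries are the coordinates.               *)
Definition Gr : charted K :=
  @Charted K grass {set 'I_n} (fun=> (n * k)%N)
    (fun J W => minor J (grmx W) != 0)
    (fun J W => mxvec (grmx W *m invmx (rows J (grmx W)))).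

(* The image of W under an invertible matrix (and W itself if the image does *)
(* not have dimension k, which never happens for an invertible matrix).      *)
Definition gr_act (A : 'M[K]_n) (W : grass) : grass :=
  insubd W (linfun (mulmx A) @: val W)%VS.

Definition Xk : charted K := prodV Gr (Gm K).

(* The integer interval [i, j], empty if j < i. *)
Definition zint (i j : int) : seq int :=
  if j < i then [::] else [seq i + l%:Z | l <- iota 0 `|j - i|.+1].

Definition Uact (u : 'M[ratfun K]_n) : pmap Xk Xk :=
  let ev (v : Xk) := map_mx (leval ((-1) ^+ k.-1 * val v.2)) u in
  PMap (fun v => ev v \in unitmx) (fun v => (gr_act (ev v) v.1, v.2)).

Definition gmap : pmap Xk 'M[ratfun K]_n :=
  PMap
    (fun v => forall j : 'I_n, pluck (zint (j.+1%:Z - k%:Z) (j.+1%:Z - 1)) v.1 != 0)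
    (fun v => \matrix_(i0 < n, j0 < n)
       let: (i, j) := (i0.+1, j0.+1) in
       (if (j <= k)%N then 1
        else if (j <= i)%N then scal (val v.2) else lambda K) *
       scal (pluck (i%:Z :: zint (j%:Z - k%:Z + 1) (j%:Z - 1)) v.1
             / pluck (zint (j%:Z - k%:Z) (j%:Z - 1)) v.1)).

Definition gr_gamma (j : nat) (v : Xk) : K :=
  (if (j <= k)%N then 1 else val v.2) *
  (pluck (zint (j%:Z - k%:Z + 1) j) v.1 / pluck (zint (j%:Z - k%:Z) (j%:Z - 1)) v.1).

Definition gr_phi (i : nat) (v : Xk) : K :=
  (if i == 0%N then (val v.2)^-1 else 1) *
  (pluck (i%:Z + 1 :: zint (i%:Z - k%:Z + 1) (i%:Z - 1)) v.1
   / pluck (zint (i%:Z - k%:Z + 1) i) v.1).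

Definition gr_eps (i : nat) (v : Xk) : K :=
  (if i == k then (val v.2)^-1 else 1) *
  ((pluck (i%:Z + 1 :: zint (i%:Z - k%:Z + 1) (i%:Z - 1)) v.1
    * pluck (zint (i%:Z - k%:Z + 1) i) v.1)
   / (pluck (zint (i%:Z - k%:Z) (i%:Z - 1)) v.1
      * pluck (zint (i%:Z - k%:Z + 2) (i%:Z + 1)) v.1)).

Definition xmx (i : 'I_n) (a : K) : 'M[K]_n :=
  1%:M + if val i == 0%N then a *: Emx _ _ n 1 else a *: Emx _ _ i i.+1.

Definition gr_e (i : 'I_n) (cv : prodV (Gm K) Xk) : Xk :=
  let: (c, v) := cv in
  let a := (val c - 1) / gr_phi i v in
  (gr_act (xmx i (if val i == 0%N then (-1) ^+ k.-1 / val v.2 * a else a)) v.1,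
   v.2).

Definition gr_crystal : crystal_maps n Xk :=
  @CrystalMaps K n Xk
    (PMap (fun v => forall j : 'I_n,
             pluck (zint (j.+1%:Z - k%:Z) (j.+1%:Z - 1)) v.1 != 0)
          (fun v => \row_(j < n) gr_gamma j.+1 v))
    (fun i => PMap (fun v => pluck (zint (i%:Z - k%:Z + 1) i) v.1 != 0) (gr_phi i))
    (fun i => PMap (fun v => pluck (zint (i%:Z - k%:Z) (i%:Z - 1)) v.1 != 0 /\
                             pluck (zint (i%:Z - k%:Z + 2) (i%:Z + 1)) v.1 != 0)
                   (gr_eps i))
    (fun i => PMap (fun cv => pluck (zint (i%:Z - k%:Z + 1) i) cv.2.1 != 0 /\
                              gr_phi i cv.2 != 0)
                   (gr_e i)).

End Grassmannian.

(* Main.v *)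
(* Evaluated at lambda = (-1)^(k-1) t, every column of g(M, t) lies in the    *)
(* column span of M: by Cramer's rule, the entries of column j are, up to a   *)
(* common factor, the coordinates of the vector of M that vanishes on the     *)
(* k - 1 cyclically consecutive rows [j-k+1, j-1].                            *)
(*                                                                            *)
(* If u g(v) = b' u' with u, u' in U and b' in B^-, then b' = u g(v) u'^-1    *)
(* has the same band as g(v) (its unfolding lives on the diagonals 0 to n-k)  *)
(* and the same ones on the lowest diagonal, because the unfoldings of u and  *)
(* u' are upper unitriangular. At the above value of lambda its columns lie   *)
(* in the column span of u.v. Since P_{[j-k,j-1]}(u.v) is nonzero, these      *)
(* conditions determine column j, and g(u.v) satisfies them too; hence        *)
(* b' = g(u.v), for all u at once, without reduction to the generators of U.  *)
(*                                                                            *)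
(* Irreducibility and all density statements come from joining two points by  *)
(* the curve s |-> span((1-s) M + s M'), on which a nonempty open set is      *)
(* cofinite; a Vandermonde matrix gives a point with no vanishing minor.      *)

From mathcomp Require Import all_boot all_order all_algebra.
From mathcomp Require Import fraction.
From mathcomp Require Import boolp classical_sets reals complex.
From mathcomp Require Import mpoly.
From mathcomp Require Import zify.
Require Import Defs.

Set Implicit Arguments.
Unset Strict Implicit.
Unset Printing Implicit Defensive.

Import Order.TTheory GRing.Theory Num.Theory.
Local Open Scope classical_set_scope.
Local Open Scope ring_scope.

(** Put z = (-1)^(k-1) t. Each entry of g(M, t) is a scalar [gcoef] times [lambda] above the
    diagonal and times 1 elsewhere ([gmapE]). Three properties are used. The unfolding lives on the
    diagonals 0 to n-k ([band_gmap]); it has ones on the diagonal n-k ([gcoef_bottom]); and at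
    lambda = z every column lies in the column span of M ([gmap_column], resting on [gap_cramer]).
    In column j the band gives k-1 zeros, on the rows [j-k+1, j-1], and a one on row j-k. These are
    k linear conditions on a vector of a k-dimensional space, and they have at most one solution
    because P_{[j-k,j-1]} is nonzero ([minor_neq0_eq]). Multiplication by upper unitriangular
    unfoldings preserves the band and its extreme diagonal ([band_unipotent]), which yields
    [gmap_equivariant].

    For the induced crystal, P_{[j-k+1,j]} is both the diagonal numerator of column j and the
    denominator of column j+1 ([gapset_diag]), so the ratios of neighbouring entries collapse to the
    stated formulas. The factors t cancel except at i = 0 for phi and at i = k for epsilon. The maps
    e_i agree because evaluating [xhat] at z gives [xmx] with the stated parameter ([leval_xhat]).

    On the geometric side, a point of a chart is represented by its normalised matrix [nmx], and
    Cramer's rule ([nmx_adj]) turns chart changes and actions into quotients with a minor as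
    denominator. Every common domain of two crystal maps is given by the nonvanishing of finitely
    many size-k minors, hence is open, and it is dense by irreducibility and [generic_point]. *)

(** * Function algebras and polynomial matrix operations *)

Section FunctionAlgebras.
Variables (K : fieldType) (T : Type).

(** Three instances occur: polynomial functions on affine space ([polyfun]), functions polynomial in
    the coordinates of a chart ([chart_poly]), and functions of one variable that are rational and
    regular at a point ([ratfun_at]). Minors, adjugates and matrix products are thus treated once
    for all three. *)
Record funalg (P : (T -> K) -> Prop) : Prop := FunAlg {
  fa_cst : forall c, P (fun=> c);
  fa_add : forall f h, P f -> P h -> P (fun x => f x + h x);
  fa_mul : forall f h, P f -> P h -> P (fun x => f x * h x) }.

Variable P : (T -> K) -> Prop.
Hypothesis faP : funalg P.

Lemma fa_opp f : P f -> P (fun x => - f x).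
Proof.
move=> Pf; have -> : (fun x => - f x) = (fun x => -1 * f x).
  by apply/funext => x; rewrite mulN1r.
exact: fa_mul faP _ _ (fa_cst faP _) Pf.
Qed.

Lemma fa_sum (I : Type) (r : seq I) (Q : pred I) (F : I -> T -> K) :
  (forall i, Q i -> P (F i)) -> P (fun x => \sum_(i <- r | Q i) F i x).
Proof.
move=> PF; elim: r => [|i r IH].
  have -> : (fun x => \sum_(i <- [::] | Q i) F i x) = (fun=> 0).
    by apply/funext => x; rewrite big_nil.
  exact: fa_cst.
have -> : (fun x => \sum_(j <- i :: r | Q j) F j x) =
    (fun x => (if Q i then F i x else 0) + \sum_(j <- r | Q j) F j x).
  by apply/funext => x; rewrite big_cons; case: ifP; rewrite ?add0r.
apply: fa_add faP _ _ _ IH.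
by case E: (Q i); [exact: PF | exact: fa_cst].
Qed.

Lemma fa_prod (I : Type) (r : seq I) (Q : pred I) (F : I -> T -> K) :
  (forall i, Q i -> P (F i)) -> P (fun x => \prod_(i <- r | Q i) F i x).
Proof.
move=> PF; elim: r => [|i r IH].
  have -> : (fun x => \prod_(i <- [::] | Q i) F i x) = (fun=> 1).
    by apply/funext => x; rewrite big_nil.
  exact: fa_cst.
have -> : (fun x => \prod_(j <- i :: r | Q j) F j x) =
    (fun x => (if Q i then F i x else 1) * \prod_(j <- r | Q j) F j x).
  by apply/funext => x; rewrite big_cons; case: ifP; rewrite ?mul1r.
apply: fa_mul faP _ _ _ IH.
by case E: (Q i); [exact: PF | exact: fa_cst].
Qed.

Lemma fa_exp f m : P f -> P (fun x => f x ^+ m).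
Proof.
move=> Pf; have -> : (fun x => f x ^+ m) = (fun x => \prod_(i < m) f x).
  by apply/funext => x; rewrite prodr_const card_ord.
exact: fa_prod.
Qed.

Lemma fa_meval m (p : {mpoly K[m]}) (h : 'I_m -> T -> K) :
  (forall l, P (h l)) -> P (fun x => p.@[fun l => h l x]).
Proof.
move=> Ph.
have -> : (fun x => p.@[fun l => h l x]) =
    (fun x => \sum_(u <- msupp p) p@_u * \prod_(i < m) h i x ^+ u i).
  by apply/funext => x; rewrite mevalE.
apply: fa_sum => u _; apply: fa_mul => //; first exact: fa_cst.
by apply: fa_prod => i _; exact: fa_exp.
Qed.

Definition fa_mx m p (A : T -> 'M[K]_(m, p)) := forall i j, P (fun x => A x i j).

Lemma fa_det m (A : T -> 'M[K]_m) : fa_mx A -> P (fun x => \det (A x)).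
Proof.
move=> PA; rewrite /determinant; apply: fa_sum => s _.
apply: fa_mul => //; first exact: fa_cst.
by apply: fa_prod => i _; exact: PA.
Qed.

Lemma fa_mulmx m p q (A : T -> 'M[K]_(m, p)) (B : T -> 'M[K]_(p, q)) :
  fa_mx A -> fa_mx B -> fa_mx (fun x => A x *m B x).
Proof.
move=> PA PB i j.
have -> : (fun x => (A x *m B x) i j) = (fun x => \sum_l A x i l * B x l j).
  by apply/funext => x; rewrite mxE.
by apply: fa_sum => l _; apply: fa_mul.
Qed.

Lemma fa_adj m (A : T -> 'M[K]_m) : fa_mx A -> fa_mx (fun x => \adj (A x)).
Proof.
move=> PA i j.
have -> : (fun x => (\adj (A x)) i j) =
    (fun x => (-1) ^+ (j + i) * \det (row' j (col' i (A x)))).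
  by apply/funext => x; rewrite mxE.
apply: fa_mul => //; first exact: fa_cst.
apply: fa_det => a b.
have -> : (fun x => row' j (col' i (A x)) a b) = (fun x => A x (lift j a) (lift i b)).
  by apply/funext => x; rewrite !mxE.
exact: PA.
Qed.

End FunctionAlgebras.

(** * Open sets and regular maps read in charts *)

Section Charts.
Variable K : fieldType.

Definition polyfun m (f : 'rV[K]_m -> K) : Prop :=
  exists p : {mpoly K[m]}, forall x, f x = p.@[x ord0].

Lemma funalg_polyfun m : funalg (@polyfun m).
Proof.
split=> [c|f h [p Ep] [q Eq]|f h [p Ep] [q Eq]].
- by exists c%:MP => x; rewrite mevalC.
- by exists (p + q) => x; rewrite mevalD Ep Eq.
- by exists (p * q) => x; rewrite mevalM Ep Eq.
Qed.

Lemma polyfun_coord m l : @polyfun m (fun x => x ord0 l).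
Proof. by exists 'X_l => x; rewrite mevalXU. Qed.

Lemma algebraic_zeros m (I : Type) (f : I -> 'rV[K]_m -> K) :
  (forall i, polyfun (f i)) -> algebraic [set x | forall i, f i x = 0].
Proof.
move=> Pf; exists [set p | exists i, forall x, f i x = p.@[x ord0]].
apply/seteqP; split => x /= H.
  by move=> p [i Ei]; rewrite -Ei.
by move=> i; have [p Ep] := Pf i; rewrite Ep; apply: H; exists i.
Qed.

Definition chart_poly (X : charted K) (i : chart X) (h : X -> K) : Prop :=
  exists p : {mpoly K[cdim i]}, forall x, cdom i x -> h x = p.@[coord i x ord0].

Lemma funalg_chart_poly (X : charted K) (i : chart X) : funalg (chart_poly i).
Proof.
split=> [c|f h [p Ep] [q Eq]|f h [p Ep] [q Eq]].
- by exists c%:MP => x _; rewrite mevalC.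
- by exists (p + q) => x xi; rewrite mevalD Ep ?Eq.
- by exists (p * q) => x xi; rewrite mevalM Ep ?Eq.
Qed.

Lemma chart_poly_coord (X : charted K) (i : chart X) l :
  chart_poly i (fun x => coord i x ord0 l).
Proof. by exists 'X_l => x _; rewrite mevalXU. Qed.

Lemma eq_chart_poly (X : charted K) (i : chart X) (f h : X -> K) :
  (forall x, cdom i x -> f x = h x) -> chart_poly i f -> chart_poly i h.
Proof. by move=> E [p Ep]; exists p => x xi; rewrite -E ?Ep. Qed.

Lemma chart_poly_fst (X Y : charted K) (i : chart (prodV X Y)) (h : X -> K) :
  chart_poly i.1 h -> chart_poly i (fun z => h z.1).
Proof.
case=> p Ep.
apply: (@eq_chart_poly _ _ (fun z => p.@[fun l => coord i z ord0 (lshift _ l)])).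
  move=> z [z1 z2]; rewrite Ep //; apply: meval_eq => l.
  by rewrite /coord /= row_mxEl.
apply: (fa_meval (funalg_chart_poly i)) => l; exact: chart_poly_coord.
Qed.

Lemma chart_poly_snd (X Y : charted K) (i : chart (prodV X Y)) (h : Y -> K) :
  chart_poly i.2 h -> chart_poly i (fun z => h z.2).
Proof.
case=> p Ep.
apply: (@eq_chart_poly _ _ (fun z => p.@[fun l => coord i z ord0 (rshift _ l)])).
  move=> z [z1 z2]; rewrite Ep //; apply: meval_eq => l.
  by rewrite /coord /= row_mxEr.
apply: (fa_meval (funalg_chart_poly i)) => l; exact: chart_poly_coord.
Qed.

Lemma zopen_nonzero (X : charted K) (O : set X) :
  (forall i : chart X, exists2 h, chart_poly i h &
     forall x, cdom i x -> (O x <-> h x != 0)) -> zopen O.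
Proof.
move=> H i; have [h [p Ep] Oh] := H i; exists [set p] => x xi.
rewrite Oh // Ep //; split=> [?|[q -> //]]; by exists p.
Qed.

(** The form in which regularity is checked later: numerators and denominator are functions on X,
    polynomial on the chart by closure properties, so no polynomial has to be written down. *)
Lemma regular_atP (X Y : charted K) (D : set X) (f : X -> Y) (x : X)
    (i : chart X) (j : chart Y) (h : 'I_(cdim j) -> X -> K) (q : X -> K) :
  (forall l, chart_poly i (h l)) -> chart_poly i q ->
  cdom i x -> q x != 0 ->
  (forall y, cdom i y -> q y != 0 -> [/\ D y, cdom j (f y) &
     forall l, coord j (f y) ord0 l = h l y / q y]) ->
  regular_at D f x.
Proof.
move=> Ph [q' Eq] xi qx H; have [p Ep] := fin_all_exists Ph.
exists i, j, p, q'; split => //; first by rewrite -Eq.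
move=> y yi; rewrite -Eq // => qy; have [Dy jy cy] := H y yi qy.
by split => // l; rewrite cy Ep.
Qed.

Lemma irreducible_zdense (X : charted K) (D : set X) :
  irreducible X -> zopen D -> D !=set0 -> zdense D.
Proof. by move=> [_ iX] oD D0 O oO O0; apply: iX. Qed.

End Charts.

(** * Irreducibility by joining points with rational curves *)

Section Curves.
Variable K : fieldType.
Hypothesis charK : [pchar K] =i pred0.

Lemma natr_inj_pchar0 : injective (fun i : nat => i%:R : K).
Proof.
move=> i j E; wlog le_ij : i j E / (i <= j)%N.
  by move=> W; case/orP: (leq_total i j) => ?; [|apply/esym]; exact: W.
have: (j - i)%:R = 0 :> K by rewrite natrB // E subrr.
by move/eqP; rewrite (pcharf0P _).1 // subn_eq0 => ji; apply/eqP; rewrite eqn_leq le_ij.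
Qed.

(** Encodes that A holds on a cofinite set of parameters containing z. *)
Definition near_pt (z : K) (A : K -> Prop) : Prop :=
  exists2 Q : {poly K}, Q.[z] != 0 & forall s, Q.[s] != 0 -> A s.

Lemma near_ptI z (A B : K -> Prop) :
  near_pt z A -> near_pt z B -> near_pt z (fun s => A s /\ B s).
Proof.
move=> [Q Qz HA] [Q' Qz' HB]; exists (Q * Q').
  by rewrite hornerM mulf_neq0.
by move=> s; rewrite hornerM mulf_eq0 negb_or => /andP[/HA ? /HB ?].
Qed.

Lemma near_ptS z (A B : K -> Prop) :
  (forall s, A s -> B s) -> near_pt z A -> near_pt z B.
Proof. by move=> AB [Q Qz HA]; exists Q => // s /HA/AB. Qed.

(** The product of the two polynomials has fewer roots than its size, while in characteristic 0 the
    integers 0, 1, 2, ... give arbitrarily many distinct field elements to test. *)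
Lemma near_pt2 z z' (A B : K -> Prop) :
  near_pt z A -> near_pt z' B -> exists s, A s /\ B s.
Proof.
move=> [Q Qz HA] [Q' Qz' HB].
have nz (R : {poly K}) w : R.[w] != 0 -> R != 0.
  by apply: contraNneq => ->; rewrite horner0.
have QQ : Q * Q' != 0 by rewrite mulf_neq0 ?(nz _ _ Qz) ?(nz _ _ Qz').
pose rs := [seq i%:R : K | i <- iota 0 (size (Q * Q'))].
have urs : uniq rs.
  by rewrite map_inj_uniq ?iota_uniq //; exact: natr_inj_pchar0.
have: ~~ all (root (Q * Q')) rs.
  apply/negP => /max_poly_roots -/(_ QQ urs).
  by rewrite size_map size_iota ltnn.
case/allPn => s _; rewrite rootE hornerM mulf_eq0 negb_or => /andP[/HA ? /HB ?].
by exists s.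
Qed.

Definition ratfun_at (z : K) (f : K -> K) : Prop :=
  exists P Q : {poly K}, Q.[z] != 0 /\ forall s, Q.[s] != 0 -> f s = P.[s] / Q.[s].

Lemma funalg_ratfun_at z : funalg (ratfun_at z).
Proof.
split=> [c|f h [p [q [qz Ef]]] [p' [q' [qz' Eh]]]|f h [p [q [qz Ef]]] [p' [q' [qz' Eh]]]].
- by exists c%:P, 1; rewrite hornerC oner_eq0; split=> // s; rewrite !hornerC divr1.
- exists (p * q' + p' * q), (q * q'); rewrite hornerM mulf_neq0 //; split => // s.
  rewrite !hornerE mulf_eq0 negb_or => /andP[qs qs'].
  by rewrite Ef // Eh // addf_div.
- exists (p * p'), (q * q'); rewrite hornerM mulf_neq0 //; split => // s.
  rewrite !hornerE mulf_eq0 negb_or => /andP[qs qs'].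
  by rewrite Ef // Eh // mulf_div.
Qed.

Lemma ratfun_at_near z f h :
  near_pt z (fun s => f s = h s) -> ratfun_at z f -> ratfun_at z h.
Proof.
move=> [R Rz Efh] [p [q [qz Ef]]]; exists (p * R), (q * R).
rewrite hornerM mulf_neq0 //; split => // s.
rewrite !hornerM mulf_eq0 negb_or => /andP[qs Rs].
by rewrite -Efh // Ef // -mulf_div divff // mulr1.
Qed.

Lemma ratfun_at_neq0 z f : ratfun_at z f -> f z != 0 -> near_pt z (fun s => f s != 0).
Proof.
move=> [p [q [qz Ef]]]; rewrite Ef // => fz.
have pz : p.[z] != 0 by apply: contraNneq fz => ->; rewrite mul0r.
exists (p * q); first by rewrite hornerM mulf_neq0.
move=> s; rewrite hornerM mulf_eq0 negb_or => /andP[ps qs].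
by rewrite Ef // mulf_neq0 // invr_eq0.
Qed.

Lemma ratfun_at_inv z f : ratfun_at z f -> f z != 0 -> ratfun_at z (fun s => (f s)^-1).
Proof.
move=> [p [q [qz Ef]]]; rewrite Ef // => fz.
have pz : p.[z] != 0 by apply: contraNneq fz => ->; rewrite mul0r.
(* The inverse q / p is written over p q, because f is known to equal p / q only where q does not
   vanish. *)
exists (q * q), (p * q); rewrite hornerM mulf_neq0 //; split=> // s.
rewrite !hornerM mulf_eq0 negb_or => /andP[ps qs].
by rewrite Ef // invf_div -mulf_div divff // mulr1.
Qed.

Definition curve_regular (X : charted K) (c : K -> X) (z : K) : Prop :=
  forall i : chart X, cdom i (c z) ->
    near_pt z (fun s => cdom i (c s)) /\
    forall l, ratfun_at z (fun s => coord i (c s) ord0 l).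

(** Regularity is asked at the two endpoints only: in between, a segment of matrices may lose rank
    and a segment in K may pass through 0. *)
Definition curve_connected (X : charted K) : Prop :=
  forall x y : X, exists c : K -> X,
    [/\ c 0 = x, c 1 = y, curve_regular c 0 & curve_regular c 1].

Lemma curve_regular_zopen (X : charted K) (c : K -> X) z (O : set X) :
  (forall x : X, exists i, cdom i x) ->
  curve_regular c z -> zopen O -> O (c z) -> near_pt z (fun s => O (c s)).
Proof.
move=> cov cz oO Oz; have [i iz] := cov (c z); have [S HS] := oO i.
have [ni ri] := cz i iz; have [p Sp pz] := (HS _ iz).1 Oz.
have rp : ratfun_at z (fun s => p.@[fun l => coord i (c s) ord0 l]).
  by apply: (fa_meval (funalg_ratfun_at z)) => l; exact: ri.
have := near_ptI ni (ratfun_at_neq0 rp pz); apply: near_ptS => s [is_ ps].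
by apply/(HS _ is_); exists p.
Qed.

(** Along a curve joining a point of O to a point of O', each open set is met at all but finitely
    many parameters, so some parameter serves both. *)
Lemma curve_connected_irreducible (X : charted K) :
  (forall x : X, exists i, cdom i x) -> [set: X] !=set0 ->
  curve_connected X -> irreducible X.
Proof.
move=> cov X0 cX; split=> // O O' oO oO' [x Ox] [y Oy].
have [c [c0 c1 r0 r1]] := cX x y.
have [||s [Os Os']] := near_pt2 (z := 0) (z' := 1) (A := fun s => O (c s)) (B := fun s => O' (c s)).
- by apply: curve_regular_zopen; rewrite ?c0.
- by apply: curve_regular_zopen; rewrite ?c1.
by exists (c s).
Qed.

Lemma curve_regular_prod (X Y : charted K) (c : K -> X) (d : K -> Y) z :
  curve_regular c z -> curve_regular d z ->
  curve_regular (X := prodV X Y) (fun s => (c s, d s)) z.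
Proof.
move=> rc rd [i j] [/= iz jz]; have [ni ri] := rc i iz; have [nj rj] := rd j jz.
split; first exact: near_ptI.
move=> l; case: (splitP l) => a Ea.
- have -> : l = lshift _ a by apply: val_inj.
  apply: ratfun_at_near (ri a); exists 1; first by rewrite hornerC oner_eq0.
  by move=> s _; rewrite row_mxEl.
- have -> : l = rshift _ a by apply: val_inj.
  apply: ratfun_at_near (rj a); exists 1; first by rewrite hornerC oner_eq0.
  by move=> s _; rewrite row_mxEr.
Qed.

Lemma curve_connected_prod (X Y : charted K) :
  curve_connected X -> curve_connected Y -> curve_connected (prodV X Y).
Proof.
move=> cX cY [x y] [x' y'].
have [c [c0 c1 r0 r1]] := cX x x'; have [d [d0 d1 s0 s1]] := cY y y'.
exists (fun s => (c s, d s)); rewrite c0 c1 d0 d1.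
by split=> //; exact: curve_regular_prod.
Qed.

Lemma horner_segment (a b s : K) :
  (a%:P + 'X * (b - a)%:P).[s] = a + s * (b - a).
Proof. by rewrite !hornerE. Qed.

Lemma curve_connected_Gm : curve_connected (Gm K).
Proof.
move=> x y.
pose f s := val x + s * (val y - val x).
have rf z : ratfun_at z f.
  exists ((val x)%:P + 'X * (val y - val x)%:P), 1.
  rewrite hornerC oner_eq0; split=> // s _.
  by rewrite hornerC divr1 horner_segment.
pose c s : Gm K := insubd x (f s).
have vc s : f s != 0 -> val (c s) = f s by move=> fs; rewrite insubdK.
have f0 : f 0 = val x by rewrite /f mul0r addr0.
have f1 : f 1 = val y by rewrite /f mul1r addrC subrK.
have c0 : c 0 = x by apply: val_inj; rewrite vc f0 //; exact: (valP x).
have c1 : c 1 = y by apply: val_inj; rewrite vc f1 //; exact: (valP y).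
have reg z : f z != 0 -> curve_regular c z.
  move=> fz [] _; split.
    by exists 1; rewrite ?hornerC ?oner_eq0.
  have nf : near_pt z (fun s => f s != 0) by exact: ratfun_at_neq0.
  move=> l; case: (splitP (m := 1) (n := 1) l) => a El.
  - have -> : l = lshift 1 a by apply: val_inj.
    apply: ratfun_at_near (rf z); move: nf; apply: near_ptS => s fs.
    by rewrite [LHS]/=/coord /= row_mxEl vc // (ord1 a) mxE eqxx mulr1n.
  - have -> : l = rshift 1 a by apply: val_inj.
    apply: ratfun_at_near (ratfun_at_inv (rf z) fz); move: nf; apply: near_ptS => s fs.
    by rewrite /coord /= row_mxEr vc // (ord1 a) mxE eqxx mulr1n.
exists c; split=> //; apply: reg; first by rewrite f0; exact: (valP x).
by rewrite f1; exact: (valP y).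
Qed.

End Curves.

(** * Products of varieties and the multiplicative group *)

Section ProductVarieties.
Variable K : fieldType.

Lemma algebraicI m (Z Z' : set 'rV[K]_m) :
  algebraic Z -> algebraic Z' -> algebraic (Z `&` Z').
Proof.
move=> [S ->] [S' ->]; exists (S `|` S'); apply/seteqP; split => x /=.
  by move=> [H H'] p [/H|/H'].
by move=> H; split=> p Sp; apply: H; [left | right].
Qed.

Lemma algebraic_preimage m p (F : 'rV[K]_m -> 'rV[K]_p) (Z : set 'rV[K]_p) :
  (forall l, polyfun (fun x => F x ord0 l)) -> algebraic Z ->
  algebraic (F @^-1` Z).
Proof.
move=> PF [S ->].
pose f (q : {q | S q}) x := (sval q).@[F x ord0].
have -> : F @^-1` [set x | forall p0, S p0 -> p0.@[x ord0] = 0] =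
          [set x | forall q, f q x = 0].
  apply/seteqP; split => x /= H; first by case=> q Sq; apply: H.
  by move=> q Sq; exact: (H (exist _ q Sq)).
apply: algebraic_zeros => -[q Sq].
exact: (fa_meval (funalg_polyfun K m) q PF).
Qed.

Lemma chart_poly_meval (X : charted K) (i : chart X) (p : {mpoly K[cdim i]}) :
  chart_poly i (fun x => p.@[coord i x ord0]).
Proof. by exists p. Qed.

Lemma variety_prod (X Y : charted K) : variety X -> variety Y -> variety (prodV X Y).
Proof.
move=> [cX iX aX tX dX] [cY iY aY tY dY]; split.
- by move=> [x y]; have [i xi] := cX x; have [j yj] := cY y; exists (i, j).
- move=> [i j] [x y] [x' y'] /set_mem[/= xi yj] /set_mem[/= xi' yj'] /eq_row_mx[Ex Ey].
  by rewrite (iX i x x') ?inE // (iY j y y') ?inE.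
- move=> [i j] /=.
  have -> : [set row_mx (coord i z.1) (coord j z.2) | z in cdom (c := prodV X Y) (i, j)] =
     (lsubmx @^-1` [set coord i x | x in cdom i]) `&`
     (rsubmx @^-1` [set coord j y | y in cdom j]).
    apply/seteqP; split => w /=.
      by move=> [[x y] [/= xi yj] <-]; rewrite row_mxKl row_mxKr; split; [exists x|exists y].
    move=> [[x xi Ex] [y yj Ey]]; exists (x, y) => //=.
    by rewrite Ex Ey hsubmxK.
  apply: algebraicI; apply: algebraic_preimage => // l.
    have -> : (fun x : 'rV[K]_(cdim i + cdim j) => lsubmx x ord0 l) =
       (fun x => x ord0 (lshift _ l)) by apply/funext => x; rewrite mxE.
    exact: polyfun_coord.
  have -> : (fun x : 'rV[K]_(cdim i + cdim j) => rsubmx x ord0 l) =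
       (fun x => x ord0 (rshift _ l)) by apply/funext => x; rewrite mxE.
  exact: polyfun_coord.
- move=> i j; have [S1 H1 T1] := tX i.1 j.1; have [S2 H2 T2] := tY i.2 j.2.
  pose lift1 (p1 : {mpoly K[cdim i.1]}) :=
    chart_poly_fst (i := i) (chart_poly_meval p1).
  pose lift2 (p2 : {mpoly K[cdim i.2]}) :=
    chart_poly_snd (i := i) (chart_poly_meval p2).
  exists [set p | exists p1 p2, [/\ S1 p1, S2 p2 & forall z, cdom i z ->
      p.@[coord i z ord0] = p1.@[coord i.1 z.1 ord0] * p2.@[coord i.2 z.2 ord0]]].
    move=> [x y] zi; have [xi yi] := zi; split.
      case=> /(H1 _ xi)[p1 Sp1 px] /(H2 _ yi)[p2 Sp2 py].
      have [p Ep] := fa_mul (funalg_chart_poly i) (lift1 p1) (lift2 p2).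
      exists p; last by rewrite -Ep // mulf_neq0.
      by exists p1, p2; split=> // z /Ep <-.
    case=> p [p1 [p2 [Sp1 Sp2 Ep]]]; rewrite (Ep (x, y)) //= mulf_eq0 negb_or => /andP[px py].
    by split; [apply/(H1 _ xi); exists p1 | apply/(H2 _ yi); exists p2].
  move=> [x y] [xi yi] [xj yj].
  have [p1 [q1 [q1x E1]]] := T1 x xi xj; have [p2 [q2 [q2y E2]]] := T2 y yi yj.
  have [q Eq] := fa_mul (funalg_chart_poly i) (lift1 q1) (lift2 q2).
  (* Both blocks of coordinates are brought over the common denominator q1 q2, each numerator being
     multiplied by the denominator of the other factor. *)
  pose h (l : 'I_(cdim j)) (z : prodV X Y) :=
    match split (l : 'I_(cdim j.1 + cdim j.2)) with
    | inl a => (p1 a).@[coord i.1 z.1 ord0] * q2.@[coord i.2 z.2 ord0]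
    | inr b => q1.@[coord i.1 z.1 ord0] * (p2 b).@[coord i.2 z.2 ord0]
    end.
  have /fin_all_exists[p Ep] : forall l, chart_poly i (h l).
    rewrite /h => l; case: (split _) => a; apply: (fa_mul (funalg_chart_poly i)).
    - exact: lift1.
    - exact: lift2.
    - exact: lift1.
    - exact: lift2.
  exists p, q; rewrite -(Eq (x, y)) //= mulf_neq0 //; split=> // z zi zj.
  rewrite -Eq //= mulf_eq0 negb_or => /andP[q1z q2z] l; rewrite -Ep // /h.
  have [zi1 zi2] := zi; have [zj1 zj2] := zj.
  rewrite mxE; case: splitP => a _.
    by rewrite (E1 z.1) // -mulf_div divff // mulr1.
  by rewrite (E2 z.2) // -mulf_div divff // mul1r.
- move=> i j /=.
  set A := [set row_mx (coord i.1 x) (coord j.1 x) | x in cdom i.1 `&` cdom j.1].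
  set B := [set row_mx (coord i.2 y) (coord j.2 y) | y in cdom i.2 `&` cdom j.2].
  (* Up to a permutation of coordinate blocks the diagonal of a product is the product of the
     diagonals; F selects the blocks of X and G those of Y. *)
  pose F (w : 'rV[K]_(cdim i.1 + cdim i.2 + (cdim j.1 + cdim j.2))) :=
    row_mx (lsubmx (lsubmx w)) (lsubmx (rsubmx w)).
  pose G (w : 'rV[K]_(cdim i.1 + cdim i.2 + (cdim j.1 + cdim j.2))) :=
    row_mx (rsubmx (lsubmx w)) (rsubmx (rsubmx w)).
  have -> : [set row_mx (coord i z) (coord j z) | z in cdom i `&` cdom j] =
     (F @^-1` A) `&` (G @^-1` B).
    apply/seteqP; split => w /=.
      move=> [[x y] [[/= xi yi] [/= xj yj]] <-]; rewrite /F /G !(row_mxKl, row_mxKr).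
      by split; [exists x | exists y].
    move=> [[x [xi xj] /eq_row_mx[Ex Ex']] [y [yi yj] /eq_row_mx[Ey Ey']]].
    exists (x, y); first by [].
    by rewrite /= Ex Ex' Ey Ey' !hsubmxK.
  have PF m1 m2 p1 p2 (l : 'I_m1 + 'I_m2) (s1 : 'rV[K]_(p1 + p2) -> 'rV_m1)
      (s2 : 'rV[K]_(p1 + p2) -> 'rV_m2) :
      (forall l, polyfun (fun x => s1 x ord0 l)) ->
      (forall l, polyfun (fun x => s2 x ord0 l)) ->
      polyfun (fun x => row_mx (s1 x) (s2 x) ord0 (unsplit l)).
    move=> P1 P2; case: l => a /=.
      have -> : (fun x => row_mx (s1 x) (s2 x) ord0 (lshift m2 a)) = (fun x => s1 x ord0 a).
        by apply/funext => x; rewrite row_mxEl.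
      exact: P1.
    have -> : (fun x => row_mx (s1 x) (s2 x) ord0 (rshift m1 a)) = (fun x => s2 x ord0 a).
      by apply/funext => x; rewrite row_mxEr.
    exact: P2.
  have Pc m (f : 'I_m -> 'I_(cdim i.1 + cdim i.2 + (cdim j.1 + cdim j.2)))
      (s : 'rV[K]_(cdim i.1 + cdim i.2 + (cdim j.1 + cdim j.2)) -> 'rV_m) :
      (forall x l, s x ord0 l = x ord0 (f l)) -> forall l, polyfun (fun x => s x ord0 l).
    move=> E l; have -> : (fun x => s x ord0 l) = (fun x => x ord0 (f l)) by apply/funext.
    exact: polyfun_coord.
  apply: algebraicI; apply: algebraic_preimage.
  + move=> l; rewrite -(splitK l); apply: PF.
      by apply: (Pc _ (fun l => lshift _ (lshift _ l))) => x a; rewrite !mxE.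
    by apply: (Pc _ (fun l => rshift _ (lshift _ l))) => x a; rewrite !mxE.
  + exact: dX.
  + move=> l; rewrite -(splitK l); apply: PF.
      by apply: (Pc _ (fun l => lshift _ (rshift _ l))) => x a; rewrite !mxE.
    by apply: (Pc _ (fun l => rshift _ (rshift _ l))) => x a; rewrite !mxE.
  + exact: dY.
Qed.

Lemma variety_Gm : variety (Gm K).
Proof.
have cE (x : Gm K) : coord (c := Gm K) tt x ord0 (lshift 1 ord0) = val x.
  by rewrite /coord /= row_mxEl mxE eqxx mulr1n.
have cE' (x : Gm K) : coord (c := Gm K) tt x ord0 (rshift 1 ord0) = (val x)^-1.
  by rewrite /coord /= row_mxEr mxE eqxx mulr1n.
have cinj : injective (coord (c := Gm K) tt).
  by move=> x y E; apply: val_inj; rewrite /= -cE E cE.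
have Pl m l := @polyfun_coord K m l; have fa m := funalg_polyfun K m.
have aGm : algebraic [set coord (c := Gm K) tt x | x in cdom (c := Gm K) tt].
  have -> : [set coord (c := Gm K) tt x | x in cdom (c := Gm K) tt] =
     [set w | forall u : unit, w ord0 (lshift 1 ord0) * w ord0 (rshift 1 ord0) + -1 = 0].
    apply/seteqP; split => w /=.
      by move=> [x _ <-] _; rewrite cE cE' divff ?subrr //; exact: (valP x).
    move=> /(_ tt)/eqP; rewrite subr_eq0 => /eqP E.
    have nz : w ord0 (lshift 1 ord0) != 0.
      by apply: contra_eq_neq E => ->; rewrite mul0r eq_sym oner_eq0.
    exists (exist (fun c : K => c != 0) _ nz : Gm K) => //; rewrite /coord /=.
    apply/rowP => l; rewrite mxE; case: splitP => a; rewrite (ord1 a) => El;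
      rewrite mxE eqxx mulr1n.
      by congr (w _ _); apply: val_inj.
    apply: (mulfI nz); rewrite divff // -E; congr (_ * w _ _); apply: val_inj => /=.
    by rewrite El.
  apply: algebraic_zeros => _; apply: fa_add; [exact: fa| |exact: fa_cst].
  by apply: fa_mul; [exact: fa|exact: Pl|exact: Pl].
split.
- by move=> x; exists tt.
- by move=> [] x y _ _; exact: cinj.
- by case.
- case=> -[]; exists [set 1].
    by move=> x _; split=> // _; exists 1 => //; rewrite meval1 oner_eq0.
  move=> x _ _; exists (fun l => 'X_l), 1; rewrite meval1 oner_eq0; split=> // y _ _ _ l.
  by rewrite meval1 divr1 mevalXU.
- case=> -[].
    have -> : [set row_mx (coord (c := Gm K) tt x) (coord (c := Gm K) tt x) | x in cdom (c := Gm K) tt `&` cdom (c := Gm K) tt] =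
      (lsubmx @^-1` [set coord (c := Gm K) tt x | x in cdom (c := Gm K) tt]) `&`
      [set w | forall l : 'I_(1 + 1), w ord0 (lshift _ l) + - w ord0 (rshift _ l) = 0].
      apply/seteqP; split => w /=.
        move=> [x _ <-]; rewrite row_mxKl; split; first by exists x.
        by move=> l; rewrite row_mxEl row_mxEr subrr.
      move=> [[x _ Ex] H]; exists x => //; rewrite Ex -[RHS]hsubmxK; congr row_mx.
      by apply/rowP => l; rewrite !mxE; apply/eqP; rewrite -subr_eq0 H.
    apply: algebraicI.
      apply: algebraic_preimage aGm => l.
      have -> : (fun x : 'rV[K]_(1 + 1 + (1 + 1)) => lsubmx x ord0 l) =
        (fun x => x ord0 (lshift _ l)) by apply/funext => x; rewrite mxE.
      exact: Pl.
    apply: algebraic_zeros => l; apply: fa_add; [exact: fa|exact: Pl|].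
    by apply: fa_opp; [exact: fa|exact: Pl].
Qed.

End ProductVarieties.

Lemma invmx_mul (F : comUnitRingType) m (A B : 'M[F]_m) :
  A \in unitmx -> B \in unitmx -> invmx (A *m B) = invmx B *m invmx A.
Proof.
move=> uA uB; have uAB : A *m B \in unitmx by rewrite unitmx_mul uA.
have E : invmx B *m invmx A *m (A *m B) = 1%:M.
  by rewrite mulmxA mulmxKV // mulVmx.
by rewrite -[RHS](mulmxK uAB) E mul1mx.
Qed.

(** * Matrices spanning a point of the Grassmannian, and their minors *)

Section GrassmannianAlgebra.
Variables (K : fieldType) (n k : nat).
Implicit Types (J : {set 'I_n}) (M : 'M[K]_(n, k)) (W : grass K n k).

(** Hides the enumeration behind [rows]. The increasing order of the rows enters only through
    [minor_increasing]. *)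
Lemma rows_rowsub J : #|J| = k ->
  exists f : 'I_k -> 'I_n, [/\ forall M, rows J M = rowsub f M,
    forall a, f a \in J, forall x, x \in J -> exists a, f a = x & injective f].
Proof.
move=> cJ; rewrite /rows; case: eqP => // e.
exists (fun a => enum_val (cast_ord (esym e) a)).
split=> // [a|x xJ|]; [exact: enum_valP| |]; last first.
  by move=> a b /enum_val_inj/cast_ord_inj.
exists (cast_ord e (enum_rank_in xJ x)).
by rewrite cast_ordK enum_rankK_in.
Qed.

Lemma rowsM J M (H : 'M_k) : rows J (M *m H) = rows J M *m H.
Proof.
rewrite /rows; case: eqP => [e|_]; last by rewrite mul0mx.
by rewrite mul_rowsub_mx.
Qed.

Lemma minorM J M (H : 'M_k) : minor J (M *m H) = minor J M * \det H.
Proof. by rewrite /minor; case: eqP => _; rewrite ?mul0r // rowsM det_mulmx. Qed.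

Lemma minor_det J M : #|J| = k -> minor J M = \det (rows J M).
Proof. by move=> e; rewrite /minor e eqxx. Qed.

Lemma minor_neq0 J M : minor J M != 0 -> #|J| = k /\ rows J M \in unitmx.
Proof.
rewrite /minor; have [e|_] := eqVneq #|J| k; last by rewrite eqxx.
by rewrite unitmxE unitfE.
Qed.

(** The block of M on the rows J is invertible, so a combination of the columns of M is determined
    by its entries in J. This is the uniqueness principle behind equivariance. *)
Lemma minor_neq0_eq J M m (X Y : 'M_(k, m)) : minor J M != 0 ->
  (forall i j, i \in J -> (M *m X) i j = (M *m Y) i j) -> X = Y.
Proof.
move=> mJ E; have [cJ uJ] := minor_neq0 mJ; have [f [fE fJ _ _]] := rows_rowsub cJ.
have : rows J M *m X = rows J M *m Y.
  rewrite fE !mul_rowsub_mx; apply/matrixP => a b.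
  by have := E (f a) b (fJ a); rewrite !mxE.
by move/(congr1 (mulmx (invmx (rows J M)))); rewrite !mulKmx.
Qed.

Lemma minor_neq0_cancel J M m (X : 'M_(k, m)) : minor J M != 0 -> M *m X = 0 -> X = 0.
Proof.
by move=> mJ E; apply: (minor_neq0_eq mJ) => i j _; rewrite E mulmx0.
Qed.

Lemma row_full_minor M : row_full M -> exists J, minor J M != 0.
Proof.
move=> fM; pose f := fullrankfun fM.
pose J := [set f a | a : 'I_k].
have cJ : #|J| = k by rewrite card_imset ?card_ord //; exact: fullrankfun_inj.
exists J; rewrite minor_det //; have [h [hE _ hJ _]] := rows_rowsub cJ.
rewrite -unitfE -unitmxE -row_full_unit -sub1mx.
have : row_full (rowsub f M) by exact: fullrowsub_full.
rewrite -sub1mx => /submx_trans -> //.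
apply/row_subP => a; have [|b hb] := hJ (f a); first exact: imset_f.
rewrite row_rowsub -hb hE -row_rowsub; exact: row_sub.
Qed.

Lemma cV_cancel_row_full M : (forall x : 'cV_k, M *m x = 0 -> x = 0) -> row_full M.
Proof.
move=> H; rewrite -cokermx_eq0; apply/eqP/matrixP => i j.
have : M *m col j (cokermx M) = 0 by rewrite colE mulmxA mulmx_coker mul0mx.
by move/H/matrixP/(_ i ord0); rewrite !mxE.
Qed.

Definition spans M W : Prop := forall x : 'cV_n, x \in val W <-> exists y, x = M *m y.

Lemma grmx_sum W (y : 'cV_k) :
  grmx W *m y = \sum_(i < k) y i ord0 *: (vbasis (val W))`_i.
Proof.
apply/colP => a; rewrite mxE summxE; apply: eq_bigr => i _.
by rewrite !mxE mulrC.
Qed.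

Lemma spans_grmx W : spans (grmx W) W.
Proof.
move=> x; split=> [xW|[y ->]].
  exists (\col_(i < k) vector.coord (vbasis (val W)) (cast_ord (esym (eqP (valP W))) i) x).
  rewrite grmx_sum {1}(coord_vbasis xW) (reindex (cast_ord (esym (eqP (valP W))))) /=.
    by apply: eq_bigr => i _; rewrite mxE.
  by apply: onW_bij; exists (cast_ord (eqP (valP W))) => i; rewrite ?cast_ordK ?cast_ordKV.
rewrite grmx_sum; apply: memv_suml => i _; apply: memvZ; apply: vbasis_mem.
by apply: mem_nth; rewrite size_tuple (eqP (valP W)).
Qed.

Lemma grmx_cancel W (x : 'cV_k) : grmx W *m x = 0 -> x = 0.
Proof.
rewrite grmx_sum => E; apply/colP => i; rewrite mxE.
pose e := eqP (valP W).
have fW : free (vbasis (val W)) by exact: basis_free (vbasisP _).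
have /freeP F := fW.
have := F (fun j => x (cast_ord e j) ord0) _ (cast_ord (esym e) i).
rewrite cast_ordKV; apply; rewrite -[RHS]E.
rewrite [RHS](reindex (cast_ord e)) //=.
by apply: onW_bij; exists (cast_ord (esym e)) => j; rewrite ?cast_ordK ?cast_ordKV.
Qed.

Lemma grmx_row_full W : row_full (grmx W).
Proof. exact/cV_cancel_row_full/grmx_cancel. Qed.

Lemma grmx_minor W : exists J, minor J (grmx W) != 0.
Proof. exact/row_full_minor/grmx_row_full. Qed.

Lemma spans_factor M W m (X : 'M_(n, m)) : spans M W ->
  (forall j, col j X \in val W) -> exists H, X = M *m H.
Proof.
move=> sM XW; have /fin_all_exists[h hE] : forall j, exists y, col j X = M *m y.
  by move=> j; apply/sM.
exists (\matrix_(i, j) h j i ord0); apply/matrixP => i j.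
have /colP/(_ i) := hE j; rewrite !mxE => ->.
by apply: eq_bigr => l _; rewrite mxE.
Qed.

Lemma spans_col M W j : spans M W -> col j M \in val W.
Proof.
move=> sM; apply/sM; exists (delta_mx j ord0).
by rewrite -colE.
Qed.

(** Each matrix factors through the other, and the composite of the two factors is the identity
    because [grmx W] cancels on the left. *)
Lemma spans_unit M W : spans M W -> exists2 H, H \in unitmx & grmx W = M *m H.
Proof.
move=> sM.
have [H HE] := spans_factor sM (fun j => spans_col j (spans_grmx W)).
have [H' HE'] := spans_factor (spans_grmx W) (fun j => spans_col j sM).
exists H => //.
have [J mJ] := grmx_minor W.
have /eqP : H' *m H - 1%:M = 0.
  by apply: (minor_neq0_cancel mJ); rewrite mulmxBr mulmx1 mulmxA -HE' -HE subrr.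
by rewrite subr_eq0 => /eqP/mulmx1_unit[].
Qed.

Lemma spans_mul M W (H : 'M_k) : H \in unitmx -> spans M W -> spans (M *m H) W.
Proof.
move=> uH sM x; rewrite sM; split=> -[y ->].
  by exists (invmx H *m y); rewrite -mulmxA mulKVmx.
by exists (H *m y); rewrite mulmxA.
Qed.

Lemma spans_uniq M W W' : spans M W -> spans M W' -> W = W'.
Proof.
move=> sM sM'; apply: val_inj; apply/vspaceP => x.
by apply/idP/idP; [move/sM/sM' | move/sM'/sM].
Qed.

(** A change of basis multiplies all Plucker coordinates by its determinant, so their vanishing and
    their ratios can be computed on any spanning matrix. *)
Lemma spans_minor M W : spans M W ->
  exists2 c, c != 0 & forall J, minor J (grmx W) = minor J M * c.
Proof.
case/spans_unit => H uH ->; exists (\det H); first by rewrite -unitfE -unitmxE.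
by move=> J; exact: minorM.
Qed.

Lemma spans_minor_neq0 M W J : spans M W -> (minor J (grmx W) != 0) = (minor J M != 0).
Proof.
case/spans_minor => c c0 ->; by rewrite mulf_eq0 (negPf c0) orbF.
Qed.

Lemma spans_dim M (U : {vspace 'cV[K]_n}) J : minor J M != 0 ->
  (forall x, x \in U <-> exists y : 'cV_k, x = M *m y) -> \dim U == k.
Proof.
move=> mJ sM; pose f := linfun (mulmx M : 'cV_k -> 'cV_n).
have -> : U = (f @: fullv)%VS.
  apply/vspaceP => x; apply/idP/memv_imgP.
    by case/sM => y ->; exists y; rewrite ?memvf ?lfunE.
  by case=> y _ ->; apply/sM; exists y; rewrite lfunE.
have /lker0P/eqP kf : injective f.
  move=> x y; rewrite !lfunE /= => /eqP; rewrite -subr_eq0 -mulmxBr => /eqP.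
  by move/(minor_neq0_cancel mJ)/eqP; rewrite subr_eq0 => /eqP.
by rewrite limg_dim_eq ?kf ?capv0 // dimvf dim_matrix mulr1.
Qed.

Lemma spans_exists M J : minor J M != 0 -> exists W, spans M W.
Proof.
move=> mJ; pose U := limg (linfun (mulmx M : 'cV_k -> 'cV_n)).
have sU x : x \in U <-> exists y : 'cV_k, x = M *m y.
  split=> [/memv_imgP[y _ ->]|[y ->]]; first by exists y; rewrite lfunE.
  by apply/memv_imgP; exists y; rewrite ?memvf ?lfunE.
by exists (exist _ U (spans_dim mJ sU)).
Qed.

(** An invertible A preserves the dimension, so the fallback value in [gr_act] is not taken. *)
Lemma spans_act (A : 'M_n) M W : A \in unitmx -> spans M W -> spans (A *m M) (gr_act A W).
Proof.
move=> uA sM.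
have sU x : x \in (linfun (mulmx A : 'cV_n -> 'cV_n) @: val W)%VS <->
    exists y : 'cV_k, x = A *m M *m y.
  split=> [/memv_imgP[z /sM[y ->] ->]|[y ->]].
    by exists y; rewrite lfunE /= mulmxA.
  apply/memv_imgP; exists (M *m y); first by apply/sM; exists y.
  by rewrite lfunE /= mulmxA.
have [J mJ] : exists J, minor J (A *m M) != 0.
  apply: row_full_minor; apply: cV_cancel_row_full => x.
  rewrite -mulmxA => /(congr1 (mulmx (invmx A))); rewrite mulKmx // mulmx0.
  have [H uH EH] := spans_unit sM.
  move=> E; have : grmx W *m (invmx H *m x) = 0 by rewrite EH -mulmxA mulKVmx.
  by move/grmx_cancel => E'; rewrite -[x](mulKVmx uH) E' mulmx0.
by move=> x; rewrite /gr_act insubdK ?sU //; exact: (spans_dim mJ sU).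
Qed.

(** When P_J is nonzero, this is the representative whose rows J form the identity; its entries are
    the coordinates of W in the chart J. *)
Definition nmx J W := grmx W *m invmx (rows J (grmx W)).

Lemma nmx_spans J W : minor J (grmx W) != 0 -> spans (nmx J W) W.
Proof.
by case/minor_neq0 => _ uJ; apply: spans_mul (spans_grmx W); rewrite unitmx_inv.
Qed.

Lemma rows_nmx J W : minor J (grmx W) != 0 -> rows J (nmx J W) = 1%:M.
Proof. by case/minor_neq0 => _ uJ; rewrite rowsM mulmxV. Qed.

Lemma spans_nmx J M W : spans M W -> minor J M != 0 -> nmx J W = M *m invmx (rows J M).
Proof.
move=> sM mJ; have [H uH E] := spans_unit sM; have [_ uJ] := minor_neq0 mJ.
by rewrite /nmx E rowsM invmx_mul // mulmxA mulmxK.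
Qed.

(** Cramer's rule puts all chart coordinates over the single denominator P_J, with numerators
    polynomial in the entries of M. *)
Lemma nmx_adj J M W : spans M W -> minor J M != 0 ->
  nmx J W = (minor J M)^-1 *: (M *m \adj (rows J M)).
Proof.
move=> sM mJ; rewrite (spans_nmx sM mJ) /invmx; have [cJ uJ] := minor_neq0 mJ.
by rewrite uJ minor_det // -scalemxAr.
Qed.

Lemma coord_nmx J W a b :
  coord (c := Gr K n k) J W ord0 (mxvec_index a b) = nmx J W a b.
Proof. by rewrite /coord /= mxvecE. Qed.

Lemma fa_rows (T : Type) (P : (T -> K) -> Prop) J (A : T -> 'M[K]_(n, k)) :
  funalg P -> fa_mx P A -> fa_mx P (fun x => rows J (A x)).
Proof.
move=> fP PA i j; have [e|ne] := eqVneq #|J| k; last first.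
  have -> : (fun x => rows J (A x) i j) = (fun=> 0).
    by apply/funext => x; rewrite /rows; case: eqP ne => // _ _; rewrite mxE.
  exact: fa_cst.
have [f [fE _ _ _]] := rows_rowsub e.
have -> : (fun x => rows J (A x) i j) = (fun x => A x (f i) j).
  by apply/funext => x; rewrite fE mxE.
exact: PA.
Qed.

Lemma fa_minor (T : Type) (P : (T -> K) -> Prop) J (A : T -> 'M[K]_(n, k)) :
  funalg P -> fa_mx P A -> P (fun x => minor J (A x)).
Proof.
move=> fP PA; rewrite /minor; case: eqP => _; last exact: fa_cst.
by apply: fa_det => //; exact: fa_rows.
Qed.

Lemma chart_poly_nmx J : fa_mx (chart_poly (X := Gr K n k) J) (nmx J).
Proof.
move=> a b; apply: (eq_chart_poly _ (chart_poly_coord (X := Gr K n k) (i := J) (mxvec_index a b))).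
by move=> W _; rewrite coord_nmx.
Qed.

End GrassmannianAlgebra.

(** * The Grassmannian and X_k as irreducible varieties *)

Section GrassmannianVariety.
Variables (K : fieldType) (n k : nat).
Local Notation Gr := (Gr K n k).
Local Notation Xk := (Xk K n k).

Lemma coord_GrE (J : chart Gr) (W : Gr) : coord J W = mxvec (nmx J W).
Proof. by []. Qed.

Lemma fa_vec_mx m (s : 'I_(n * k) -> 'I_m) (F : 'rV[K]_m -> 'rV[K]_(n * k)) :
  (forall w l, F w ord0 l = w ord0 (s l)) ->
  fa_mx (@polyfun K m) (fun w => vec_mx (F w) : 'M_(n, k)).
Proof.
move=> FE a b.
have -> : (fun w => (vec_mx (F w) : 'M_(n, k)) a b) = (fun w => w ord0 (s (mxvec_index a b))).
  by apply/funext => w; rewrite mxE FE.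
exact: polyfun_coord.
Qed.

Lemma spans_of_rows1 (J : {set 'I_n}) (A : 'M[K]_(n, k)) :
  minor J A = 1 -> rows J A = 1%:M -> exists W : Gr, [/\ spans A W, minor J (grmx W) != 0 & nmx J W = A].
Proof.
move=> mA rA; have mA0 : minor J A != 0 by rewrite mA oner_eq0.
have [W sW] := spans_exists mA0; exists W; split=> //.
  by rewrite (spans_minor_neq0 _ sW).
by rewrite (spans_nmx sW mA0) rA invmx1 mulmx1.
Qed.

Lemma algebraic_Gr_chart (J : chart Gr) : algebraic [set coord J W | W in cdom J].
Proof.
(* If the size of J is not k, the chart has empty domain and [minor] has the default value 0; the
   equation minor = 1 then makes the right side empty too. *)
have -> : [set coord J W | W in cdom J] =
   [set w | forall u : unit, minor J (vec_mx w : 'M[K]_(n, k)) + -1 = 0] `&`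
   [set w | forall ab, rows J (vec_mx w : 'M[K]_(n, k)) ab.1 ab.2 + - (ab.1 == ab.2)%:R = 0].
  apply/seteqP; split => w /=.
    move=> [W mW <-]; rewrite mxvecK -/(nmx J W).
    have [cJ _] := minor_neq0 mW; have rW := rows_nmx mW.
    split=> [_|[a b]]; first by rewrite minor_det // rW det1 subrr.
    by rewrite rW mxE subrr.
  move=> [/(_ tt)/eqP + H]; rewrite subr_eq0 => /eqP mA.
  have [|W [sW JW nW]] := spans_of_rows1 mA.
    by apply/matrixP => a b; have /eqP := H (a, b); rewrite subr_eq0 => /eqP ->; rewrite mxE.
  by exists W => //; rewrite -/(nmx J W) nW vec_mxK.
have fV : fa_mx (@polyfun K _) (fun w : 'rV[K]_(n * k) => vec_mx w : 'M[K]_(n, k)).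
  exact: (@fa_vec_mx _ id).
have fP := funalg_polyfun K (n * k).
apply: algebraicI; apply: algebraic_zeros.
  by move=> _; apply: fa_add => //; [exact: fa_minor | exact: fa_cst].
by move=> [a b]; apply: fa_add => //; [exact: fa_rows | exact: fa_cst].
Qed.

Lemma variety_Gr : variety Gr.
Proof.
split.
- exact: grmx_minor.
- move=> J W W'; rewrite !inE => mW mW'; rewrite !coord_GrE => /(can_inj mxvecK) E.
  by apply: (spans_uniq (nmx_spans mW)); rewrite E; exact: nmx_spans.
- exact: algebraic_Gr_chart.
- move=> J J'.
  have fP := funalg_chart_poly (X := Gr) J; have fN := @chart_poly_nmx K n k J.
  have [q Eq] := fa_minor J' fP fN.
  exists [set q].
    move=> W mW; rewrite /= (spans_minor_neq0 _ (nmx_spans mW)) Eq //.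
    by split=> [?|[_ -> //]]; exists q.
  move=> W mW mW'.
  have fE : fa_mx (chart_poly (X := Gr) J) (fun W => nmx J W *m \adj (rows J' (nmx J W))).
    by apply: fa_mulmx => //; apply: fa_adj => //; exact: fa_rows.
  pose h (l : 'I_(n * k)) (W : Gr) := mxvec (nmx J W *m \adj (rows J' (nmx J W))) ord0 l.
  have /fin_all_exists[p Ep] : forall l, chart_poly (X := Gr) J (h l).
    move=> l; case/mxvec_indexP: l => a b.
    by apply: eq_chart_poly (fE a b) => V _; rewrite /h mxvecE.
  exists p, q; rewrite -Eq //; split.
    by rewrite -(spans_minor_neq0 _ (nmx_spans mW)).
  move=> V mV mV'; rewrite -Eq // => qV l; rewrite -Ep // /h coord_GrE.
  case/mxvec_indexP: l => a b; rewrite !mxvecE (nmx_adj (nmx_spans mV) qV) mxE.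
  by rewrite mulrC.
- move=> J J'.
  pose A (w : 'rV[K]_(n * k + n * k)) : 'M[K]_(n, k) := vec_mx (lsubmx w).
  pose B (w : 'rV[K]_(n * k + n * k)) : 'M[K]_(n, k) := vec_mx (rsubmx w).
  (* For normalised matrices A and B of the charts J and J', having the same span means A (rows J B)
     = B, an equation without denominators. Conversely it gives (rows J' A)(rows J B) = 1, so the
     factor relating A and B is invertible. *)
  have -> : [set row_mx (coord J W) (coord J' W) | W in cdom J `&` cdom J'] =
     (lsubmx @^-1` [set coord J W | W in cdom J]) `&`
     ((rsubmx @^-1` [set coord J' W | W in cdom J']) `&`
     [set w | forall ab, (A w *m rows J (B w)) ab.1 ab.2 + - B w ab.1 ab.2 = 0]).
    apply/seteqP; split => w.
      move=> [W [mW mW'] <-]; rewrite /A /B /=; split; first by exists W; rewrite ?row_mxKl.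
      split; first by exists W; rewrite ?row_mxKr.
      move=> [a b]; rewrite /= row_mxKl row_mxKr !mxvecK -/(nmx J W) -/(nmx J' W).
      have [_ uJ] := minor_neq0 mW.
      by rewrite {1}/nmx {1}/nmx rowsM mulmxA mulmxKV // subrr.
    move=> [[W mW EW] [[V mV EV] H]].
    have EA : A w = nmx J W by rewrite /A -EW coord_GrE mxvecK.
    have EB : B w = nmx J' V by rewrite /B -EV coord_GrE mxvecK.
    have E : A w *m rows J (B w) = B w.
      by apply/matrixP => a b; apply/eqP; rewrite -subr_eq0; exact/eqP/(H (a, b)).
    have /mulmx1_unit[uA uB] : rows J' (A w) *m rows J (B w) = 1%:M.
      by rewrite -rowsM E EB rows_nmx.
    have WV : W = V.
      apply: (spans_uniq (M := B w)); last by rewrite EB; exact: nmx_spans.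
      by rewrite -E; apply: spans_mul => //; rewrite EA; exact: nmx_spans.
    exists W; first by split=> //; rewrite WV.
    by rewrite EW WV EV hsubmxK.
  have fA : fa_mx (@polyfun K _) A.
    by apply: (@fa_vec_mx (n * k + n * k) (@lshift (n * k) (n * k)) lsubmx) => w l; rewrite mxE.
  have fB : fa_mx (@polyfun K _) B.
    by apply: (@fa_vec_mx (n * k + n * k) (@rshift (n * k) (n * k)) rsubmx) => w l; rewrite mxE.
  have fP := funalg_polyfun K (n * k + n * k).
  apply: algebraicI; first apply: algebraic_preimage (algebraic_Gr_chart J) => l.
    have -> : (fun x : 'rV[K]_(n * k + n * k) => lsubmx x ord0 l) =
       (fun x => x ord0 (lshift _ l)) by apply/funext => x; rewrite mxE.
    exact: polyfun_coord.
  apply: algebraicI; first apply: algebraic_preimage (algebraic_Gr_chart J') => l.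
    have -> : (fun x : 'rV[K]_(n * k + n * k) => rsubmx x ord0 l) =
       (fun x => x ord0 (rshift _ l)) by apply/funext => x; rewrite mxE.
    exact: polyfun_coord.
  apply: algebraic_zeros => -[a b]; apply: fa_add => //; last exact: fa_opp.
  by apply: fa_mulmx => //; exact: fa_rows.
Qed.

Lemma curve_connected_Gr : curve_connected Gr.
Proof.
move=> x y.
pose M s : 'M[K]_(n, k) := grmx x + s *: (grmx y - grmx x).
(* Where the segment of matrices loses rank, c takes the default value x. *)
pose c s : Gr := xget x [set W | spans (M s) W].
have cP s W : spans (M s) W -> c s = W.
  move=> sW; apply: (spans_uniq _ sW); rewrite /c; case: xgetP => [V _ //|/(_ W)//].
have cS s J : minor J (M s) != 0 -> spans (M s) (c s).
  by case/spans_exists => W sW; rewrite (cP s W).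
have rM z : fa_mx (ratfun_at z) M.
  move=> a b; exists ((grmx x a b)%:P + 'X * (grmx y a b - grmx x a b)%:P), 1.
  rewrite hornerC oner_eq0; split=> // s _.
  by rewrite hornerC divr1 horner_segment /M !mxE.
have reg z : spans (M z) (c z) -> curve_regular c z.
  move=> sz J cz; have mz : minor J (M z) != 0 by rewrite -(spans_minor_neq0 _ sz).
  have fz := funalg_ratfun_at z.
  have nJ := ratfun_at_neq0 (fa_minor J fz (rM z)) mz; split.
    by move: nJ; apply: near_ptS => s ms; rewrite /= (spans_minor_neq0 _ (cS _ _ ms)).
  move=> l; case/mxvec_indexP: l => a b.
  have fE : ratfun_at z (fun s => (minor J (M s))^-1 * (M s *m \adj (rows J (M s))) a b).
    apply: fa_mul => //; first by apply: ratfun_at_inv => //; exact: fa_minor.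
    by apply: fa_mulmx => //; apply: fa_adj => //; exact: fa_rows.
  apply: ratfun_at_near fE; move: nJ; apply: near_ptS => s ms.
  by rewrite coord_nmx (nmx_adj (cS _ _ ms) ms) [RHS]mxE.
have s0 : spans (M 0) x by rewrite /M scale0r addr0; exact: spans_grmx.
have s1 : spans (M 1) y by rewrite /M scale1r addrC subrK; exact: spans_grmx.
exists c; split; rewrite ?(cP _ _ s0) ?(cP _ _ s1) //; apply: reg.
  by rewrite (cP _ _ s0).
by rewrite (cP _ _ s1).
Qed.

Lemma variety_Xk : variety Xk.
Proof. by apply: variety_prod; [exact: variety_Gr | exact: variety_Gm]. Qed.

Lemma curve_connected_Xk : curve_connected Xk.
Proof. by apply: curve_connected_prod; [exact: curve_connected_Gr|exact: curve_connected_Gm]. Qed.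

Hypotheses (charK : [pchar K] =i pred0) (le_kn : (k <= n)%N).

(* Row i of the matrix below is (1, i, i^2, ...): its minors are Vandermonde determinants. *)
Lemma generic_point : exists W : Gr, forall J : {set 'I_n}, #|J| = k -> minor J (grmx W) != 0.
Proof.
pose M : 'M[K]_(n, k) := \matrix_(i, j) i%:R ^+ j.
have mM (J : {set 'I_n}) : #|J| = k -> minor J M != 0.
  move=> cJ; rewrite minor_det //; have [f [fE _ _ fI]] := rows_rowsub K cJ.
  have -> : rows J M = (Vandermonde k (\row_j (f j)%:R))^T.
    by rewrite fE; apply/matrixP => a b; rewrite !mxE.
  rewrite det_tr det_Vandermonde; apply/prodf_neq0 => i _; apply/prodf_neq0 => j ij.
  rewrite !mxE subr_eq0; apply: contraTneq ij => /(natr_inj_pchar0 charK)/val_inj/fI ->.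
  by rewrite ltnn.
have [J cJ] : exists J : {set 'I_n}, #|J| = k.
  exists [set widen_ord le_kn a | a : 'I_k].
  by rewrite card_imset ?card_ord // => a b /(congr1 val)/= /val_inj.
have [W sW] := spans_exists (mM J cJ).
by exists W => J' /mM; rewrite (spans_minor_neq0 _ sW).
Qed.

Lemma irreducible_Xk : irreducible Xk.
Proof.
apply: curve_connected_irreducible => //; last exact: curve_connected_Xk.
  by have [] := variety_Xk.
have [W _] := generic_point.
by exists (W, exist (fun c : K => c != 0) 1 (oner_neq0 K)).
Qed.

Lemma irreducible_Gm_Xk : irreducible (prodV (Gm K) Xk).
Proof.
apply: curve_connected_irreducible => //.
- by have [] := variety_prod (variety_Gm K) variety_Xk.
- have [W _] := generic_point.
  pose o : Gm K := exist (fun c : K => c != 0) 1 (oner_neq0 K).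
  by exists (o, (W, o)).
- by apply: curve_connected_prod; [exact: curve_connected_Gm|exact: curve_connected_Xk].
Qed.

End GrassmannianVariety.

(** * Coefficients and values of Laurent polynomials *)

Section LaurentPolynomials.
Variable K : fieldType.
Implicit Types (f h : ratfun K) (p q : {poly K}).

Lemma lambda_neq0 : lambda K != 0.
Proof. by rewrite tofrac_eq0 polyX_eq0. Qed.

Lemma lambdaXn d : lambda K ^+ d = tofrac 'X^d.
Proof. by rewrite /lambda -rmorphXn. Qed.

Lemma lfracX p d e : lfrac (p * 'X^e, (d + e)%N) = lfrac (p, d).
Proof.
rewrite /lfrac /= exprD rmorphM /= -lambdaXn -mulf_div divff ?mulr1 //.
by rewrite expf_neq0 // lambda_neq0.
Qed.

Lemma lfracD p q d : lfrac (p, d) + lfrac (q, d) = lfrac (p + q, d).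
Proof. by rewrite /lfrac /= rmorphD mulrDl. Qed.

Lemma lfracM p q d e : lfrac (p, d) * lfrac (q, e) = lfrac (p * q, (d + e)%N).
Proof. by rewrite /lfrac /= rmorphM exprD mulf_div. Qed.

Lemma laurent_common f h : laurent f -> laurent h ->
  exists p q d, f = lfrac (p, d) /\ h = lfrac (q, d).
Proof.
move=> [[p d] ->] [[q e] ->]; exists (p * 'X^e), (q * 'X^d), (d + e)%N.
by rewrite lfracX addnC lfracX.
Qed.

Lemma laurentD f h : laurent f -> laurent h -> laurent (f + h).
Proof.
move=> lf lh; have [p [q [d [-> ->]]]] := laurent_common lf lh.
by rewrite lfracD; eexists.
Qed.

Lemma laurentM f h : laurent f -> laurent h -> laurent (f * h).
Proof. by move=> [[p d] ->] [[q e] ->]; rewrite lfracM; eexists. Qed.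

Lemma scalE (c : K) : scal c = lfrac (c%:P, 0%N).
Proof. by rewrite /lfrac /= expr0 divr1. Qed.

Lemma lambdaE : lambda K = lfrac ('X : {poly K}, 0%N).
Proof. by rewrite /lfrac /= expr0 divr1. Qed.

Lemma laurent_scal (c : K) : laurent (scal c).
Proof. by rewrite scalE; eexists. Qed.

Lemma laurent_lambda : laurent (lambda K).
Proof. by rewrite lambdaE; eexists. Qed.

Lemma scal0 : scal 0 = 0 :> ratfun K.
Proof. by rewrite /scal rmorph0. Qed.

Lemma scal1 : scal 1 = 1 :> ratfun K.
Proof. by rewrite /scal rmorph1. Qed.

Lemma scalM (a b : K) : scal (a * b) = scal a * scal b.
Proof. by rewrite /scal !rmorphM. Qed.

Lemma scalN (a : K) : scal (- a) = - scal a.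
Proof. by rewrite /scal !rmorphN. Qed.

Lemma laurent0 : laurent (0 : ratfun K).
Proof. rewrite -scal0; exact: laurent_scal. Qed.

Lemma laurent1 : laurent (1 : ratfun K).
Proof. rewrite -scal1; exact: laurent_scal. Qed.

Lemma laurent_sum (I : Type) (r : seq I) (F : I -> ratfun K) :
  (forall i, laurent (F i)) -> laurent (\sum_(i <- r) F i).
Proof. by move=> lF; elim/big_ind: _ => //; [exact: laurent0 | exact: laurentD]. Qed.

Lemma levalD z f h : z != 0 -> laurent f -> laurent h ->
  leval z (f + h) = leval z f + leval z h.
Proof.
move=> z0 lf lh; have [p [q [d [-> ->]]]] := laurent_common lf lh.
by rewrite lfracD !leval_lfrac // hornerD mulrDl.
Qed.

Lemma levalM z f h : z != 0 -> laurent f -> laurent h ->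
  leval z (f * h) = leval z f * leval z h.
Proof.
move=> z0 [[p d] ->] [[q e] ->].
by rewrite lfracM !leval_lfrac // hornerM exprD mulf_div.
Qed.

Lemma leval_scal (z c : K) : z != 0 -> leval z (scal c) = c.
Proof. by move=> z0; rewrite scalE leval_lfrac // hornerC expr0 divr1. Qed.

Lemma leval_lambda z : z != 0 -> leval z (lambda K) = z.
Proof. by move=> z0; rewrite lambdaE leval_lfrac // hornerX expr0 divr1. Qed.

Lemma leval_scal_lambda z c : z != 0 -> leval z (scal c / lambda K) = c / z.
Proof.
by move=> z0; rewrite -[scal c / _]/(lfrac (c%:P, 1%N)) leval_lfrac // hornerC.
Qed.

Lemma leval0 (z : K) : z != 0 -> leval z 0 = 0.
Proof. by move=> z0; rewrite -scal0 leval_scal. Qed.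

Lemma leval1 (z : K) : z != 0 -> leval z 1 = 1.
Proof. by move=> z0; rewrite -scal1 leval_scal. Qed.

Lemma leval_sum z (I : Type) (r : seq I) (F : I -> ratfun K) : z != 0 ->
  (forall i, laurent (F i)) -> leval z (\sum_(i <- r) F i) = \sum_(i <- r) leval z (F i).
Proof.
move=> z0 lF; elim: r => [|i r IH]; first by rewrite !big_nil leval0.
by rewrite !big_cons levalD ?IH //; exact: laurent_sum.
Qed.

Lemma lcoefD f h m : laurent f -> laurent h -> lcoef (f + h) m = lcoef f m + lcoef h m.
Proof.
move=> lf lh; have [p [q [d [-> ->]]]] := laurent_common lf lh.
by rewrite lfracD !lcoef_lfrac; case: (m + d%:Z) => l; rewrite ?coefD ?addr0.
Qed.

Lemma lcoef_nth p d (l : nat) : lcoef (lfrac (p, d)) (l%:Z - d%:Z) = p`_l.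
Proof. by rewrite lcoef_lfrac subrK. Qed.

Lemma lcoef_eq f h : laurent f -> laurent h -> (forall m, lcoef f m = lcoef h m) -> f = h.
Proof.
move=> lf lh; have [p [q [d [-> ->]]]] := laurent_common lf lh => E.
suff -> : p = q by [].
by apply/polyP => l; rewrite -(lcoef_nth p d) E lcoef_nth.
Qed.

(** A coefficient of a product is a convolution. Band arguments need only its vanishing, so the
    convolution formula itself is not stated. *)
Lemma lcoefM0 f h m : laurent f -> laurent h ->
  (forall m1 m2, m1 + m2 = m -> lcoef f m1 = 0 \/ lcoef h m2 = 0) ->
  lcoef (f * h) m = 0.
Proof.
move=> [[p d] ->] [[q e] ->] H; rewrite lfracM lcoef_lfrac.
case E: (m + _) => [r|//]; rewrite coefM big1 // => j _.
have [||] := H (j%:Z - d%:Z) ((r - j)%N%:Z - e%:Z); rewrite ?lcoef_nth.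
- by have := ltn_ord j; lia.
- by move->; rewrite mul0r.
- by move->; rewrite mulr0.
Qed.

Lemma lcoef_scal (c : K) m : lcoef (scal c) m = if m == 0 then c else 0.
Proof.
rewrite scalE lcoef_lfrac addr0; case: m => // l.
by rewrite coefC.
Qed.

Lemma lcoef_lambda_scal c m : lcoef (lambda K * scal c) m = if m == 1 then c else 0.
Proof.
rewrite scalE lambdaE lfracM lcoef_lfrac addr0 mulrC; case: m => // l.
by rewrite coefMX; case: l => [|l] //=; rewrite coefC.
Qed.

Lemma lcoef_scal_lambda c m : lcoef (scal c / lambda K) m = if m == -1 then c else 0.
Proof.
rewrite -[scal c / _]/(lfrac (c%:P, 1%N)) lcoef_lfrac -[m == -1]subr_eq0 opprK.
by case: (m + 1) => // l; rewrite coefC.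
Qed.

Lemma lcoef0 m : lcoef (0 : ratfun K) m = 0.
Proof. by rewrite -scal0 lcoef_scal if_same. Qed.

End LaurentPolynomials.

(** * Band matrices and unitriangular unfoldings *)

Section LoopMatrices.
Variables (K : fieldType) (n : nat).
Implicit Types (A B : 'M[ratfun K]_n).

Definition laurent_mx A : Prop := forall i j, laurent (A i j).

Lemma laurent_mulmx A B : laurent_mx A -> laurent_mx B -> laurent_mx (A *m B).
Proof. by move=> lA lB i j; rewrite mxE; apply: laurent_sum => l; exact: laurentM. Qed.

Lemma laurent_1mx : laurent_mx 1%:M.
Proof.
by move=> i j; rewrite mxE; case: (i == j); [exact: laurent1 | exact: laurent0].
Qed.

Lemma leval_mulmx z A B : z != 0 -> laurent_mx A -> laurent_mx B ->
  map_mx (leval z) (A *m B) = map_mx (leval z) A *m map_mx (leval z) B.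
Proof.
move=> z0 lA lB; apply/matrixP => i j; rewrite !mxE leval_sum // => [|l].
  by apply: eq_bigr => l _; rewrite levalM // !mxE.
exact: laurentM.
Qed.

Lemma leval_1mx (z : K) : z != 0 -> map_mx (leval z) 1%:M = 1%:M :> 'M_n.
Proof.
by move=> z0; apply/matrixP => i j; rewrite !mxE; case: (i == j); rewrite ?leval1 ?leval0.
Qed.

(* The unfolding X of A satisfies X_{pq} = 0 whenever p - q > d. *)
Definition band (d : int) A : Prop := laurent_mx A /\
  forall (i j : 'I_n) (m : int), d < m * n%:Z + i%:Z - j%:Z -> lcoef (A i j) m = 0.

(** The diagonal indices p - q add up in a product, so in each term beyond d + e one factor lies
    beyond its own band. *)
Lemma band_mul d e A B : band d A -> band e B -> band (d + e) (A *m B).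
Proof.
move=> [lA bA] [lB bB]; split; first exact: laurent_mulmx.
move=> i j m lt_m; rewrite mxE; apply: (big_ind (fun f => laurent f /\ lcoef f m = 0) _ _ _).2.
- by split; [exact: laurent0 | exact: lcoef0].
- by move=> f h [lf f0] [lh h0]; rewrite lcoefD // f0 h0 addr0; split=> //; exact: laurentD.
move=> l _; split; first exact: laurentM.
apply: lcoefM0 => // m1 m2 Em; have [lt_m1|le_m1] := ltP d (m1 * n%:Z + i%:Z - l%:Z).
  by left; exact: bA.
by right; apply: bB; move: lt_m; rewrite -Em mulrDl; lia.
Qed.

Lemma band_add d A B : band d A -> band d B -> band d (A + B).
Proof.
move=> [lA bA] [lB bB]; split=> [i j|i j m lt_m]; rewrite mxE; first exact: laurentD.
by rewrite lcoefD // bA // bB // addr0.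
Qed.

Lemma band_le d e A : d <= e -> band d A -> band e A.
Proof. by move=> le_de [lA bA]; split=> // i j m lt_m; apply: bA; exact: le_lt_trans lt_m. Qed.

(** Upper unitriangularity of the unfolding, for A and for its inverse; the symmetric form makes
    closure under inversion immediate. *)
Definition unipotent A : Prop := [/\ A \in unitmx, band (-1) (A - 1%:M) &
  band (-1) (invmx A - 1%:M)].

Lemma band_sub1_mul A B : band (-1) (A - 1%:M) -> band (-1) (B - 1%:M) ->
  band (-1) (A *m B - 1%:M).
Proof.
move=> bA bB.
have -> : A *m B - 1%:M = (A - 1%:M) *m (B - 1%:M) + ((A - 1%:M) + (B - 1%:M)).
  by rewrite mulmxBr mulmx1 mulmxBl mul1mx [RHS]addrA subrK subrKA.
apply: band_add; last exact: band_add.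
by apply: band_le (band_mul bA bB).
Qed.

Lemma unipotent1 : unipotent 1%:M.
Proof.
have b : band (-1) (1%:M - 1%:M).
  rewrite subrr; split=> [i j|i j m _]; rewrite mxE; first exact: laurent0.
  exact: lcoef0.
by split; rewrite ?unitmx1 ?invmx1.
Qed.

Lemma unipotent_mul A B : unipotent A -> unipotent B -> unipotent (A *m B).
Proof.
move=> [uA bA bA'] [uB bB bB']; split; first by rewrite unitmx_mul uA.
  exact: band_sub1_mul.
by rewrite (invmx_mul uA uB); exact (band_sub1_mul bB' bA').
Qed.

Lemma unipotent_inv A : unipotent A -> unipotent (invmx A).
Proof. by move=> [uA bA bA']; split; [rewrite unitmx_inv | exact bA' | rewrite invmxK]. Qed.

Lemma Emx_sq (T : pzRingType) (r s : nat) : r != s -> Emx n T r s *m Emx n T r s = 0.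
Proof.
move=> rs; apply/matrixP => i j; rewrite !mxE big1 // => l _; rewrite !mxE.
have [/andP[_ /eqP ->]|] := boolP (_ && (l.+1 == s)); last by rewrite mul0r.
by rewrite eq_sym (negPf rs) mulr0.
Qed.

Hypothesis n_ge2 : (2 <= n)%N.

(** The matrix unit involved is off the diagonal because n >= 2, hence has square zero. *)
Lemma xhat_mulN (i : 'I_n) (a : K) : xhat i a *m xhat i (- a) = 1%:M.
Proof.
have H (c : ratfun K) r s : r != s ->
    (1%:M + c *: Emx n _ r s) *m (1%:M + (- c) *: Emx n _ r s) = 1%:M.
  move=> rs; rewrite mulmxDl !mulmxDr !mul1mx mulmx1 -scalemxAl -scalemxAr Emx_sq //.
  by rewrite !scaler0 addr0 scaleNr subrK.
rewrite /xhat; case: ifP => _; rewrite scalN ?mulNr; apply: H; lia.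
Qed.

Lemma band_xhat (i : 'I_n) (a : K) : band (-1) (xhat i a - 1%:M).
Proof.
rewrite /xhat addrC addKr; case: ifP => i0; split=> [r s|r s m lt_m]; rewrite !mxE.
- case: (_ && _); rewrite ?mulr1 ?mulr0; last exact: laurent0.
  by rewrite -[scal a / _]/(lfrac (a%:P, 1%N)); eexists.
- have [/andP[rn s1]|_] := boolP (_ && _); rewrite ?mulr1 ?mulr0 ?lcoef0 //.
  by rewrite lcoef_scal_lambda; case: eqP => // Em; move: lt_m; rewrite Em; lia.
- case: (_ && _); rewrite ?mulr1 ?mulr0; [exact: laurent_scal | exact: laurent0].
- have [/andP[rn s1]|_] := boolP (_ && _); rewrite ?mulr1 ?mulr0 ?lcoef0 //.
  by rewrite lcoef_scal; case: eqP => // Em; move: lt_m; rewrite Em; lia.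
Qed.

Lemma unipotent_xhat (i : 'I_n) (a : K) : unipotent (xhat i a).
Proof.
have E := xhat_mulN i a; have [ux _] := mulmx1_unit E.
split=> //; first exact: band_xhat.
have -> : invmx (xhat i a) = xhat i (- a) by rewrite -[LHS]mulmx1 -E mulKmx.
exact: band_xhat.
Qed.

Lemma inU_unipotent (u : 'M[ratfun K]_n) : inU u -> unipotent u.
Proof.
elim=> [i a|| v w _ uv _ uw|v _ uv].
- exact: unipotent_xhat.
- exact: unipotent1.
- exact: unipotent_mul.
- exact: unipotent_inv.
Qed.

Lemma unipotent_laurent A : unipotent A -> laurent_mx A.
Proof.
move=> [_ [lA _] _] i j; have := laurentD (lA i j) (laurent_1mx i j).
by rewrite !mxE subrK.
Qed.

Lemma unipotent_leval z A : z != 0 -> unipotent A -> map_mx (leval z) A \in unitmx.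
Proof.
move=> z0 uA; have [/mulmxV E _ _] := uA.
have := leval_mulmx z0 (unipotent_laurent uA) (unipotent_laurent (unipotent_inv uA)).
by rewrite E leval_1mx // => /esym/mulmx1_unit[].
Qed.

(** Multiplication by upper unitriangular matrices moves entries only towards smaller p - q, so the
    extreme diagonal p - q = d is unchanged. *)
Lemma band_unipotent d A B C : band d A -> unipotent B -> unipotent C ->
  band (d - 1) (B *m A *m C - A).
Proof.
move=> bA [_ bB _] [_ bC _].
have bBA : band (d - 1) ((B - 1%:M) *m A).
  by apply: band_le (band_mul bB bA); rewrite addrC.
have -> : B *m A *m C - A = (B - 1%:M) *m A + ((B - 1%:M) *m A + A) *m (C - 1%:M).
  by rewrite mulmxBl mul1mx subrK mulmxBr mulmx1 [RHS]addrC subrKA.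
apply: band_add => //; apply: band_mul bC; apply: band_add => //.
by apply: band_le bBA; lia.
Qed.

End LoopMatrices.

(** * Laplace expansion along an inserted row *)

Section MinorExpansion.
Variables (K : fieldType) (n k : nat).
Implicit Types (M : 'M[K]_(n, k)) (J : {set 'I_n}).

Lemma minor_increasing J (f : 'I_k -> 'I_n) M :
  {homo f : a b / (a < b)%N} -> J =i codom f -> minor J M = \det (rowsub f M).
Proof.
move=> f_incr Jf.
have enumJ : enum J = map f (enum 'I_k).
  have tr : transitive (fun a b : 'I_n => (a < b)%N) by move=> b a c; exact: ltn_trans.
  have ir : irreflexive (fun a b : 'I_n => (a < b)%N) by move=> a; exact: ltnn.
  have srt m : sorted (fun a b : 'I_m => (a < b)%N) (enum 'I_m).
    by have := iota_ltn_sorted 0 m; rewrite -val_enum_ord sorted_map.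
  apply: (irr_sorted_eq tr ir).
  - by rewrite /enum_mem; apply: sorted_filter => //; rewrite -enumT; exact: srt.
  - by apply: homo_sorted (srt k) => a b; exact: f_incr.
  - by move=> a; rewrite mem_enum Jf.
have cJ : #|J| = k by rewrite cardE enumJ size_map size_enum_ord.
rewrite minor_det // /rows; case: eqP => // e; congr (\det _).
apply/matrixP => a b; rewrite !mxE; congr (M _ b).
rewrite /enum_val enumJ (nth_map a) ?size_enum_ord //=.
by apply: (congr1 f); apply: val_inj; rewrite /= nth_enum_ord.
Qed.

Definition insert_row (pos : 'I_k) (i : 'I_n) (s : 'I_k.-1 -> 'I_n) (a : 'I_k) : 'I_n :=
  if unlift pos a is Some b then s b else i.

(* Expansion along the inserted row: its cofactors do not depend on i. *)
Definition cofactor_col (s : 'I_k.-1 -> 'I_n) M : 'cV[K]_k :=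
  \col_c ((-1) ^+ c * \det (rowsub s (col' c M))).

(** Only the sign remembers the place where row i is inserted; the vector of cofactors is the same
    for all i, so these determinants are, up to sign, the entries of one vector in the span of M. *)
Lemma det_insert_row pos i s M :
  \det (rowsub (insert_row pos i s) M) = (-1) ^+ pos * (M *m cofactor_col s M) i ord0.
Proof.
rewrite (expand_det_row _ pos) mxE mulr_sumr; apply: eq_bigr => c _.
rewrite /cofactor [in RHS]mxE [in LHS]mxE /insert_row unlift_none.
have -> : row' pos (col' c (rowsub (insert_row pos i s) M)) = rowsub s (col' c M).
  by apply/matrixP => a b; rewrite !mxE /insert_row liftK.
by rewrite exprD -!mulrA mulrCA.
Qed.

(** Inserting at position 0 a row that is already present gives a determinant with a repeated
    row. *)
Lemma cofactor_col_row i s M : (exists b, s b = i) ->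
  (M *m cofactor_col s M) i ord0 = 0.
Proof.
move=> [b sb]; have kk : (0 < k)%N by have := ltn_ord b; lia.
pose pos : 'I_k := Ordinal kk.
have := det_insert_row pos i s M; rewrite (determinant_alternate (i1 := pos) (i2 := lift pos b)).
- by move/esym/eqP; rewrite mulf_eq0 signr_eq0 => /eqP.
- exact: neq_lift.
- by move=> c; rewrite !mxE /insert_row unlift_none liftK sb.
Qed.

End MinorExpansion.

(** * Sets of integers modulo n *)

Section Residues.
Variable n : nat.

Lemma mem_zint p q m : (m \in zint p q) = (p <= m <= q).
Proof.
rewrite /zint; case: ltP => pq; first by rewrite in_nil; lia.
apply/mapP/idP => [[l]|H]; first by rewrite mem_iota => H ->; lia.
by exists `|m - p|%N; rewrite ?mem_iota; lia.
Qed.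

Lemma mem_residues (I : seq int) (a : 'I_n) :
  reflect (exists2 m, m \in I & exists c, m = a.+1%:Z + c * n%:Z) (a \in residues n I).
Proof.
rewrite inE; apply: (iffP hasP) => -[m mI].
  rewrite eqz_mod_dvd => /dvdzP[c E]; exists m => //; exists c; lia.
by case=> c Em; exists m => //; rewrite Em eqz_mod_dvd addrC addKr dvdz_mull.
Qed.

Lemma sub_residues (I I' : seq int) (c : int) :
  (forall m, m \in I -> m + c * n%:Z \in I') -> residues n I \subset residues n I'.
Proof.
move=> H; apply/fintype.subsetP => a /mem_residues[m mI [d Em]]; apply/mem_residues.
by exists (m + c * n%:Z); [exact: H | exists (d + c); rewrite Em; lia].
Qed.

Lemma eq_residues (I I' : seq int) : I =i I' -> residues n I = residues n I'.
Proof.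
by move=> E; apply/eqP; rewrite finset.eqEsubset !(sub_residues (c := 0)) // => m; rewrite mul0r addr0 E.
Qed.

Lemma residues_shift (I I' : seq int) :
  (forall m, (m + n%:Z \in I') = (m \in I)) -> residues n I = residues n I'.
Proof.
move=> H; apply/eqP; rewrite finset.eqEsubset (sub_residues (c := 1)) ?(sub_residues (c := -1)) // => m.
  by rewrite mulN1r => mI'; rewrite -H subrK.
by rewrite mul1r H.
Qed.

Lemma val_ord_pred (i : 'I_n) : nat_of_ord (ord_pred i) = if i == 0%N :> nat then n.-1 else i.-1.
Proof.
rewrite /=; have := ltn_ord i; case: eqP => [->|i0] lt_i; first by rewrite add0n modn_small; lia.
have -> : ((i + n).-1 = i.-1 + n)%N by lia.
by rewrite modnDr modn_small; lia.
Qed.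

Lemma residues_cons (m : int) (I I' : seq int) : residues n I = residues n I' ->
  residues n (m :: I) = residues n (m :: I').
Proof.
move=> E; apply/finset.setP => a; have /finset.setP/(_ a) := E.
by rewrite !inE /= => ->.
Qed.

(** Crystal maps are indexed by 0, ..., n-1, whereas an ordinal j stands for column j+1. Index i
    thus belongs to column [ord_pred i], with a translation by n when i = 0. *)
Lemma residues_pred (f : int -> seq int) :
  (forall x m, (m + n%:Z \in f (x + n%:Z)) = (m \in f x)) ->
  forall i : 'I_n, residues n (f i%:Z) = residues n (f (ord_pred i).+1%:Z).
Proof.
move=> H i; have E := val_ord_pred i; have := ltn_ord i; move: E.
case: eqP => [-> -> n0|i0 -> _]; last by congr (residues n (f _)); lia.
have -> : n.-1.+1%:Z = 0 + n%:Z by lia.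
by apply: residues_shift => m; exact: H.
Qed.

End Residues.

(** * Cramer's rule for cyclically consecutive rows *)

Section CyclicMinors.
Variables (K : fieldType) (n k : nat).
Hypothesis k_range : (0 < k < n)%N.
Implicit Types i j a : 'I_n.

(* With rows and columns numbered from 0, [gap j a] says that row a is one of *)
(* the k-1 cyclically consecutive rows preceding row j.                       *)
Definition gap j a := ((a < j) && (j < a + k)%N || (n + j < a + k))%N.

Lemma mem_residues_gap j a :
  (a \in residues n (zint (j.+1%:Z - k%:Z + 1) (j.+1%:Z - 1))) = gap j a.
Proof.
have aj := ltn_ord a; have jn := ltn_ord j.
apply/mem_residues/idP => [[m]|]; rewrite /gap.
  rewrite mem_zint => H [c Em].
  have [c0|[c1|[c1|c2]]] : c = 0 \/ c = -1 \/ c >= 1 \/ c <= -2 by lia.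
  - by move: Em; rewrite c0; lia.
  - by move: Em; rewrite c1; lia.
  - have : n%:Z <= c * n%:Z by nia.
    lia.
  - have : c * n%:Z <= - (2%:Z * n%:Z) by nia.
    lia.
case/orP => H.
  by exists a.+1%:Z; [rewrite mem_zint; lia | exists 0; lia].
by exists (a.+1%:Z - n%:Z); [rewrite mem_zint; lia | exists (-1); lia].
Qed.

(** The row set of the numerator of the entry of g in row i and column j; for i = [gap_pred j] it is
    the row set of the denominator. *)
Definition gapset j i := residues n (i.+1%:Z :: zint (j.+1%:Z - k%:Z + 1) (j.+1%:Z - 1)).

Lemma mem_gapset j i a : (a \in gapset j i) = (a == i) || gap j a.
Proof.
rewrite -mem_residues_gap !inE /= ; congr (_ || _).
apply/idP/eqP => [|->]; last by rewrite eqz_mod_dvd subrr dvdz0.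
rewrite eqz_mod_dvd => /dvdzP[c E].
have ai := ltn_ord a; have i_n := ltn_ord i; apply: val_inj => /=.
have [c0|[c1|c1]] : c = 0 \/ c >= 1 \/ c <= -1 by lia.
- by move: E; rewrite c0; lia.
- have : n%:Z <= c * n%:Z by nia.
  lia.
- have : c * n%:Z <= - n%:Z by nia.
  lia.
Qed.

Fact gap_pred_subproof j : ((if k <= j then j - k else n + j - k) < n)%N.
Proof. by have := ltn_ord j; case: ifP; lia. Qed.

Definition gap_pred j : 'I_n := Ordinal (gap_pred_subproof j).

Lemma gapset_pred j :
  gapset j (gap_pred j) = residues n (zint (j.+1%:Z - k%:Z) (j.+1%:Z - 1)).
Proof.
have jn := ltn_ord j; apply/finset.setP => a; rewrite mem_gapset; apply/idP/mem_residues.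
  case/orP => [/eqP ->|].
    exists (j.+1%:Z - k%:Z); first by rewrite mem_zint; lia.
    rewrite /=; case: ifP => kj; first by exists 0; lia.
    by exists (-1); lia.
  rewrite -mem_residues_gap => /mem_residues[m]; rewrite mem_zint => H [c E].
  by exists m; [rewrite mem_zint; lia | exists c].
case=> m; rewrite mem_zint => H [c E].
have [Em|ne] := eqVneq m (j.+1%:Z - k%:Z); last first.
  apply/orP; right; rewrite -mem_residues_gap; apply/mem_residues; exists m; last by exists c.
  by rewrite mem_zint; lia.
apply/orP; left; apply/eqP; apply: val_inj => /=; have aj := ltn_ord a.
have [c0|[c1|[c1|c2]]] : c = 0 \/ c = -1 \/ c >= 1 \/ c <= -2 by lia.
- by move: E; rewrite c0; case: ifP; lia.
- by move: E; rewrite c1; case: ifP; lia.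
- have : n%:Z <= c * n%:Z by nia.
  lia.
- have : c * n%:Z <= - (2%:Z * n%:Z) by nia.
  lia.
Qed.

Fact gap_row_subproof j (b : 'I_k.-1) :
  ((if k <= j then j + 1 - k + b else if b < j then nat_of_ord b else b + n - k + 1) < n)%N.
Proof. by have := ltn_ord j; have := ltn_ord b; case: ifP => ?; [|case: ifP]; lia. Qed.

(** The gap rows in increasing order. For j < k the gap may wrap around: the rows 0 to j-1 come
    first, then those at the bottom of the matrix. *)
Definition gap_row j (b : 'I_k.-1) : 'I_n := Ordinal (gap_row_subproof j b).

Lemma gap_rowP j a : reflect (exists b, gap_row j b = a) (gap j a).
Proof.
have jn := ltn_ord j; have an := ltn_ord a; rewrite /gap; apply: (iffP idP) => [H|[b <-]].
  have [kj|jk] := leqP k j.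
    have bP : (a + k - j - 1 < k.-1)%N by lia.
    by exists (Ordinal bP); apply: val_inj; rewrite /= kj; lia.
  have [aj|ja] := ltnP a j.
    have bP : (a < k.-1)%N by lia.
    by exists (Ordinal bP); apply: val_inj; rewrite /= leqNgt jk aj.
  have bP : (a + k - n - 1 < k.-1)%N by lia.
  by exists (Ordinal bP); apply: val_inj; rewrite /= leqNgt jk; case: ifP; lia.
by have := ltn_ord b; rewrite /=; case: ifP => ?; [|case: ifP]; lia.
Qed.

Lemma gap_row_incr j (b b' : 'I_k.-1) : (b < b')%N -> (gap_row j b < gap_row j b')%N.
Proof.
move=> lt_b; have := ltn_ord b'; rewrite /=; case: ifP => ? ?; first by lia.
by case: ifP => ?; case: ifP => ?; lia.
Qed.

Lemma gap_row_inj j : injective (gap_row j).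
Proof.
move=> b b' E; apply: val_inj; case: (ltngtP b b') => // /(gap_row_incr j); rewrite E ltnn //.
Qed.

(* The position of row i among the rows of [gapset j i] in increasing order. *)
Definition gap_pos j i : nat := if (k <= j)%N then (if (i < j)%N then 0%N else k.-1) else j.

(** If row i is in the gap, both sides vanish: a repeated row on the left, a set of only k-1 rows on
    the right. Otherwise row i is inserted at its place in the increasing order, and its position
    gives the sign. *)
Lemma gap_cramer j i (M : 'M[K]_(n, k)) :
  (M *m cofactor_col (gap_row j) M) i ord0 = (-1) ^+ gap_pos j i * minor (gapset j i) M.
Proof.
have jn := ltn_ord j; have i_n := ltn_ord i.
have [gi|ngi] := boolP (gap j i).
  rewrite cofactor_col_row; last exact/gap_rowP.
  suff cJ : #|gapset j i| = k.-1 by rewrite /minor cJ ifN ?mulr0 //; lia.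
  have -> : gapset j i = [set gap_row j b | b : 'I_k.-1].
    apply/finset.setP => a; rewrite mem_gapset; apply/idP/imsetP.
      case/orP => [/eqP ->|/gap_rowP[b <-]]; last by exists b.
      by have /gap_rowP[b <-] := gi; exists b.
    by case=> b _ ->; apply/orP; right; apply/gap_rowP; exists b.
  by rewrite card_imset ?card_ord //; exact: gap_row_inj.
have pP : (gap_pos j i < k)%N by rewrite /gap_pos; case: ifP => ?; [case: ifP|]; lia.
pose pos := Ordinal pP.
have sE (b : 'I_k.-1) : if (b < pos)%N then (gap_row j b < i)%N else (i < gap_row j b)%N.
  have := ltn_ord b; move: ngi; rewrite /gap /= /gap_pos.
  by case: (leqP k j) => ?; case: (ltnP i j) => ?; do ?case: (ltnP b _) => ?; lia.
rewrite (minor_increasing (f := insert_row pos i (gap_row j))).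
- by rewrite det_insert_row mulrA -exprD addnn -signr_odd odd_double mul1r.
- move=> a b; rewrite /insert_row; case: unliftP => [a' ->|->]; case: unliftP => [b' ->|->].
  + move=> lt_ab; apply: gap_row_incr; move: lt_ab; rewrite /= /bump; lia.
  + by have := sE a'; rewrite /= /bump; case: ifP => //; lia.
  + by have := sE b'; rewrite /= /bump; case: ifP => //; lia.
  + by rewrite ltnn.
- move=> a; rewrite mem_gapset; apply/idP/codomP.
    case/orP => [/eqP ->|/gap_rowP[b <-]].
      by exists pos; rewrite /insert_row unlift_none.
    by exists (lift pos b); rewrite /insert_row liftK.
  case=> b ->; rewrite /insert_row; case: unliftP => [b' _|_]; last by rewrite eqxx.
  by apply/orP; right; apply/gap_rowP; exists b'.
Qed.

End CyclicMinors.

(** * The matrix g(M, t): support, unfolding and column span *)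

Section CrystalMap.
Variables (K : fieldType) (n k : nat).
Hypothesis k_range : (0 < k < n)%N.
Local Notation Xk := (Xk K n k).
Local Notation gapset := (@gapset n k).
Local Notation gap_pred := (gap_pred k_range).
Local Notation gmap := (@gmap K n k).
Implicit Types (i j : 'I_n) (v : Xk).

Lemma minor_gap (M : 'M[K]_(n, k)) j i : gap k j i -> minor (gapset j i) M = 0.
Proof.
move=> g; have := gap_cramer k_range j i M.
rewrite cofactor_col_row; last exact/gap_rowP.
by move/esym/eqP; rewrite mulf_eq0 signr_eq0 => /eqP.
Qed.

Lemma gapset_next i : residues n ((i%:Z + 1) :: zint (i%:Z - k%:Z + 1) (i%:Z - 1))
  = gapset (ord_pred i) i.
Proof.
have -> : i%:Z + 1 = i.+1%:Z by lia.
apply: residues_cons.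
by apply: (residues_pred (f := fun x => zint (x - k%:Z + 1) (x - 1))) => x m; rewrite !mem_zint; lia.
Qed.

Lemma residues_gapset_pred i :
  residues n (zint (i%:Z - k%:Z + 1) i) = gapset i (gap_pred i).
Proof. by rewrite gapset_pred; congr (residues n (zint _ _)); lia. Qed.

Lemma residues_ord_pred i :
  residues n (zint (i%:Z - k%:Z) (i%:Z - 1)) = gapset (ord_pred i) (gap_pred (ord_pred i)).
Proof.
rewrite gapset_pred.
by apply: (residues_pred (f := fun x => zint (x - k%:Z) (x - 1))) => x m; rewrite !mem_zint; lia.
Qed.

Lemma residues_gapset_diag (x : int) j : x = j.+1%:Z ->
  residues n (zint (x - k%:Z + 1) x) = gapset j j.
Proof. by move->; apply: eq_residues => m; rewrite inE !mem_zint; lia. Qed.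

(** The diagonal numerator of a column is the denominator of the cyclically next column. Hence the
    diagonal of g is nonzero wherever g is defined. *)
Lemma gapset_diag i : gapset (ord_pred i) (ord_pred i) = gapset i (gap_pred i).
Proof.
rewrite -(residues_gapset_diag (erefl _)) -residues_gapset_pred; apply/esym.
by apply: (residues_pred (f := fun x => zint (x - k%:Z + 1) x)) => x m; rewrite !mem_zint; lia.
Qed.

Definition cminor v j i : K := minor (gapset j i) (grmx v.1).

Definition gcoef v j i : K :=
  (if (k <= j)%N && (j <= i)%N then val v.2 else 1) * (cminor v j i / cminor v j (gap_pred j)).

Lemma pdom_gmap v : pdom gmap v <-> forall j, cminor v j (gap_pred j) != 0.
Proof. by split=> H j; have := H j; rewrite /cminor /pluck gapset_pred. Qed.

Lemma cminor_diag v j : pdom gmap v -> cminor v j j != 0.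
Proof. by move/pdom_gmap => H; have := H (ordS j); rewrite /cminor -gapset_diag ordSK. Qed.

Lemma gcoef_gap v j i : gap k j i -> gcoef v j i = 0.
Proof. by move=> g; rewrite /gcoef /cminor minor_gap // mul0r mulr0. Qed.

Lemma gcoef_diag v j : pdom gmap v -> gcoef v j j != 0.
Proof.
move=> dv; rewrite /gcoef !mulf_neq0 ?invr_eq0 ?cminor_diag //.
  by case: ifP => _; rewrite ?oner_eq0 //; exact: (valP v.2).
exact: (pdom_gmap v).1.
Qed.

(** In the first k columns all rows above the diagonal lie in the gap and the entry is 0, so the
    factor [lambda] can be written there as well. *)
Lemma gmapE v i j : gmap v i j = (if (i < j)%N then lambda K else 1) * scal (gcoef v j i).
Proof.
rewrite mxE /pluck -/(gapset j i) -gapset_pred -/(cminor v j i) -/(cminor v j (gap_pred j)).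
rewrite /gcoef; case: (ltnP j k) => jk /=.
  rewrite !mul1r; case: ifP => ij; last by rewrite mul1r.
  have g : gap k j i by rewrite /gap; lia.
  by rewrite /cminor (minor_gap _ g) mul0r scal0 mulr0.
rewrite ltnS; case: (leqP j i) => ji; last by rewrite mul1r.
by rewrite [RHS]mul1r [RHS]scalM.
Qed.

Lemma laurent_gmap v : laurent_mx (gmap v).
Proof.
move=> i j; rewrite gmapE; apply: laurentM; last exact: laurent_scal.
by case: ifP => _; [exact: laurent_lambda | exact: laurent1].
Qed.

Lemma lcoef_gmap v i j m :
  lcoef (gmap v i j) m = if m == (i < j)%N%:Z then gcoef v j i else 0.
Proof. by rewrite gmapE; case: ifP => _; rewrite ?lcoef_lambda_scal // mul1r lcoef_scal. Qed.

Lemma leval_gmap v z i j : z != 0 ->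
  leval z (gmap v i j) = (if (i < j)%N then z else 1) * gcoef v j i.
Proof.
move=> z0; rewrite gmapE levalM //; last exact: laurent_scal.
  by rewrite leval_scal //; case: ifP => _; rewrite ?leval_lambda ?leval1.
by case: ifP => _; [exact: laurent_lambda | exact: laurent1].
Qed.

Lemma int_residue (p : int) : exists (r : int) (i : 'I_n), p = r * n%:Z + i.+1%:Z.
Proof.
have n0 : n%:Z != 0 by lia.
have := divz_eq (p - 1) n%:Z; have := modz_ge0 (p - 1) n0; have := ltz_pmod (p - 1) (d := n%:Z).
case: (modz _ _) => // l lt_l _ E.
have l_n : (l < n)%N by move: lt_l; rewrite ltz_nat; apply; lia.
by exists ((p - 1) %/ n%:Z)%Z, (Ordinal l_n); move: E => /=; lia.
Qed.

Lemma det_gmap v : pdom gmap v -> \det (gmap v) != 0.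
Proof.
move=> dv.
(* Only nonnegative powers of lambda occur, so lambda = 0 may be substituted; the matrix becomes
   lower triangular with nonzero diagonal. *)
pose Q : 'M[{poly K}]_n := \matrix_(i, j) ((if (i < j)%N then 'X else 1) * (gcoef v j i)%:P).
have EQ : gmap v = map_mx (@tofrac _) Q.
  by apply/matrixP => i j; rewrite gmapE !mxE rmorphM /=; case: ifP; rewrite ?rmorph1.
have -> : \det (gmap v) = tofrac (\det Q) by rewrite EQ; exact: det_map_mx.
rewrite tofrac_eq0; apply/eqP => /(congr1 (horner_eval 0)).
rewrite -det_map_mx rmorph0; apply/eqP; rewrite det_trig.
  apply/prodf_neq0 => i _; rewrite 2!mxE ltnn mul1r /= /horner_eval hornerC.
  exact: gcoef_diag.
by apply/is_trig_mxP => i j ij; rewrite 2!mxE ij /= /horner_eval hornerM hornerX mul0r.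
Qed.

Lemma unfolding_gmap v (r s : int) i j :
  unfolding (gmap v) (r * n%:Z + i.+1%:Z) (s * n%:Z + j.+1%:Z) =
  if r - s == (i < j)%N%:Z then gcoef v j i else 0.
Proof. by rewrite unfoldingE lcoef_gmap. Qed.

Lemma gmap_Bminus v : pdom gmap v -> inBminus (gmap v).
Proof.
move=> dv; split.
- by split; [exact: laurent_gmap | exact: det_gmap].
- move=> p q; have [r [i ->]] := int_residue p; have [s [j ->]] := int_residue q.
  rewrite unfolding_gmap => lt_pq; case: eqP => // rs; exfalso.
  have Er : r = s + (i < j)%N%:Z by lia.
  by have := ltn_ord j; move: lt_pq; rewrite Er mulrDl; case: ltnP => ij /=; rewrite ?mul1r ?mul0r; lia.
- move=> p; have [r [i ->]] := int_residue p.
  by rewrite unfolding_gmap subrr ltnn eqxx; exact: gcoef_diag.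
Qed.

(** For i = 0 the column of index 0 is column n of the preceding period, which accounts for the
    block index -1. *)
Lemma unfolding_gmap_next v i : unfolding (gmap v) (i%:Z + 1) i = gcoef v (ord_pred i) i.
Proof.
have E := val_ord_pred i; have i_n := ltn_ord i.
have -> : i%:Z + 1 = 0 * n%:Z + i.+1%:Z by lia.
have -> : unfolding (gmap v) (0 * n%:Z + i.+1%:Z) i =
   unfolding (gmap v) (0 * n%:Z + i.+1%:Z) (- (i == 0%N :> nat)%:Z * n%:Z + (ord_pred i).+1%:Z).
  by congr unfolding; rewrite E; case: eqP => ?; lia.
rewrite unfolding_gmap ifT //; rewrite E; case: (eqVneq (i : nat) 0%N) => i0; lia.
Qed.

Lemma unfolding_gmap_diag v (x : int) j : x = j.+1%:Z -> unfolding (gmap v) x x = gcoef v j j.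
Proof.
by move->; rewrite -[j.+1%:Z]add0r -(mul0r n%:Z) unfolding_gmap subrr ltnn eqxx.
Qed.

Lemma unfolding_gmap_prev v i :
  unfolding (gmap v) i i = gcoef v (ord_pred i) (ord_pred i).
Proof.
have E := val_ord_pred i; have i_n := ltn_ord i.
have -> : unfolding (gmap v) i i =
   unfolding (gmap v) (- (i == 0%N :> nat)%:Z * n%:Z + (ord_pred i).+1%:Z)
                      (- (i == 0%N :> nat)%:Z * n%:Z + (ord_pred i).+1%:Z).
  by congr unfolding; rewrite E; case: eqP => ?; lia.
by rewrite unfolding_gmap subrr ltnn eqxx.
Qed.

Definition lambda_val v : K := (-1) ^+ k.-1 * val v.2.

Lemma lambda_val_neq0 v : lambda_val v != 0.
Proof. by rewrite mulf_neq0 ?signr_eq0 //; exact: (valP v.2). Qed.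

(* At lambda = (-1)^(k-1) t the signs of [gap_cramer] cancel, so that every *)
(* column of g(M, t) lies in the column span of M.                          *)
Lemma gmap_column v j : exists y : 'cV[K]_k,
  col j (map_mx (leval (lambda_val v)) (gmap v)) = grmx v.1 *m y.
Proof.
(* For j >= k the sign is 1 when i < j and (-1)^(k-1) when i >= j, and z times these is z and t, as
   required. For j < k the sign (-1)^j is constant on the rows outside the gap. *)
pose c : K := (if (k <= j)%N then lambda_val v else (-1) ^+ j) / cminor v j (gap_pred j).
exists (c *: cofactor_col (gap_row k_range j) (grmx v.1)); apply/colP => i.
rewrite -scalemxAr [RHS]mxE gap_cramer -/(cminor v j i) 2!mxE leval_gmap ?lambda_val_neq0 //.
rewrite /gcoef /c /gap_pos /lambda_val.
have sgn m : (-1) ^+ m * (-1) ^+ m = 1 :> K by rewrite -exprD addnn -signr_odd odd_double.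
case: (leqP k j) => jk; case: (ltnP i j) => ij /=.
- by rewrite expr0 !mul1r mulrCA mulrC -!mulrA [_ * cminor v j i]mulrC.
- by rewrite mul1r [RHS]mulrCA -!mulrA mulrA !mulrA sgn mul1r
      -!mulrA [_ * cminor v j i]mulrC.
- have g : gap k j i by rewrite /gap; lia.
  by rewrite [cminor v j i]minor_gap // mul0r !mulr0.
- by rewrite !mul1r [RHS]mulrACA sgn mul1r mulrC.
Qed.

Lemma band_gmap v : band (n%:Z - k%:Z) (gmap v).
Proof.
split=> [|i j m lt_m]; first exact: laurent_gmap.
rewrite lcoef_gmap; case: eqP => // Em; apply: gcoef_gap; move: lt_m; rewrite Em /gap.
by have := ltn_ord i; have := ltn_ord j; case: (ltnP i j); lia.
Qed.

(** Row j-k is where column j meets the extreme diagonal p - q = n - k of the band. *)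
Lemma gcoef_bottom v j : pdom gmap v -> gcoef v j (gap_pred j) = 1.
Proof.
move=> /pdom_gmap dv; rewrite /gcoef divff // mulr1 ifF //=.
by have := ltn_ord j; case: ifP; lia.
Qed.

End CrystalMap.

(** * The action of U and the equivariance of g *)

Section Equivariance.
Variables (K : fieldType) (n k : nat).
Hypothesis k_range : (0 < k < n)%N.
Local Notation Xk := (Xk K n k).
Local Notation gmap := (@gmap K n k).
Local Notation Uact := (@Uact K n k).
Local Notation gcoef := (@gcoef K n k k_range).
Implicit Types (i j : 'I_n) (v : Xk) (u : 'M[ratfun K]_n).

Let n_ge2 : (2 <= n)%N. Proof. by lia. Qed.

Lemma col_mulmx m p q (A : 'M[K]_(m, p)) (B : 'M[K]_(p, q)) l :
  col l (A *m B) = A *m col l B.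
Proof. by rewrite !colE mulmxA. Qed.

Lemma gmap_factor v : exists Y,
  map_mx (leval (lambda_val v)) (gmap v) = grmx v.1 *m Y.
Proof.
apply: (spans_factor (spans_grmx v.1)) => j.
by apply/(spans_grmx v.1); exact: gmap_column.
Qed.

Lemma gr_act_factor (A : 'M[K]_n) (W : grass K n k) : A \in unitmx ->
  exists H, A *m grmx W = grmx (gr_act A W) *m H.
Proof.
move=> uA; have [H uH ->] := spans_unit (spans_act uA (spans_grmx W)).
by exists (invmx H); rewrite mulmxK.
Qed.

Lemma gmap_equivariant u v b' : inU u -> pdom gmap v -> pdom gmap (Uact u v) ->
  Bact u (gmap v) b' -> gmap (Uact u v) = b'.
Proof.
move=> /(inU_unipotent n_ge2) Uu dv dw [[[lb _] tri _] [u' /(inU_unipotent n_ge2) Uu' E]].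
set w := Uact u v; pose z := lambda_val v.
have z0 : z != 0 by exact: lambda_val_neq0.
have ux' : u' \in unitmx by case: Uu'.
have Eb : b' = u *m gmap v *m invmx u' by rewrite E mulmxK.
have bdiff : band (n%:Z - k%:Z - 1) (b' - gmap v).
  by rewrite Eb; exact: band_unipotent (band_gmap k_range v) Uu (unipotent_inv Uu').
have lg : laurent_mx (gmap v) by exact: (laurent_gmap k_range).
have lcoefB i j m : lcoef (b' i j) m = lcoef ((b' - gmap v) i j) m + lcoef (gmap v i j) m.
  by rewrite -lcoefD //; [rewrite !mxE subrK | case: bdiff].
have bb : forall i j (m : int), n%:Z - k%:Z < m * n%:Z + i%:Z - j%:Z -> lcoef (b' i j) m = 0.
  move=> i j m lt_m; rewrite lcoefB; have [_ ->] := bdiff; last by lia.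
  by have [_ ->] := band_gmap k_range v; rewrite ?add0r.
have bl i j (m : int) : m * n%:Z + i%:Z - j%:Z < 0 -> lcoef (b' i j) m = 0.
  move=> lt_m; rewrite -[m]subr0 -unfoldingE; apply: tri; lia.
pose beta i j := lcoef (b' i j) (i < j)%N%:Z.
(* The diagonals 0 to n-k form a band narrower than n, so each entry of b' keeps a single power of
   lambda, the same one as in g. *)
have b_supp i j m : m != (i < j)%N%:Z -> lcoef (b' i j) m = 0.
  move=> ne_m; have i_n := ltn_ord i; have j_n := ltn_ord j.
  have [lt_m|gt_m] : m <= (i < j)%N%:Z - 1 \/ m >= (i < j)%N%:Z + 1 by lia.
    apply: bl; have : m * n%:Z <= ((i < j)%N%:Z - 1) * n%:Z by nia.
    by case: ltnP; lia.
  apply: bb; have : m * n%:Z >= ((i < j)%N%:Z + 1) * n%:Z by nia.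
  by case: ltnP; lia.
have beta_gap i j : gap k j i -> beta i j = 0.
  move=> g; apply: bb; move: g; rewrite /gap; have i_n := ltn_ord i.
  by case: ltnP; lia.
(* The difference b' - g(v) vanishes on the diagonal p - q = n - k, where g(v) has its ones. *)
have beta_bottom j : beta (gap_pred k_range j) j = 1.
  rewrite /beta lcoefB lcoef_gmap eqxx gcoef_bottom //; have [_ ->] := bdiff; rewrite ?add0r //.
  have j_n := ltn_ord j; rewrite /=; case: (leqP k j) => kj; case: ltnP; lia.
have b_E i j : b' i j = (if (i < j)%N then lambda K else 1) * scal (beta i j).
  apply: lcoef_eq => [||m]; first exact: lb.
    by apply: laurentM; [case: ifP => _; [exact: laurent_lambda | exact: laurent1] | exact: laurent_scal].
  have -> : lcoef ((if (i < j)%N then lambda K else 1) * scal (beta i j)) m =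
      if m == (i < j)%N%:Z then beta i j else 0.
    by case: ifP => _; rewrite ?lcoef_lambda_scal // mul1r lcoef_scal.
  by case: eqP => [->//|/eqP/b_supp].
have b_val i j : leval z (b' i j) = (if (i < j)%N then z else 1) * beta i j.
  rewrite b_E levalM //; last exact: laurent_scal.
    by rewrite leval_scal //; case: ifP => _; rewrite ?leval_lambda ?leval1.
  by case: ifP => _; [exact: laurent_lambda | exact: laurent1].
have [Y EY] := gmap_factor v.
have [H0 EH0] := gr_act_factor v.1 (unipotent_leval z0 Uu).
have Ebz : map_mx (leval z) b' =
    grmx w.1 *m (H0 *m Y *m map_mx (leval z) (invmx u')).
  have lu := unipotent_laurent Uu; have lu' := unipotent_laurent (unipotent_inv Uu').
  rewrite Eb leval_mulmx //; last exact: laurent_mulmx.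
  rewrite leval_mulmx // EY !mulmxA EH0 //.
have [Y' EY'] := gmap_factor w.
have zw : lambda_val w = z by [].
rewrite zw in EY'; apply/matrixP => i j; rewrite b_E gmapE.
suff <- : beta i j = gcoef w j i by [].
have nz i' : (if (i' < j)%N then z else 1) != 0 by case: ifP; rewrite ?oner_eq0.
apply: (mulfI (nz i)); rewrite -b_val -leval_gmap //.
set X := (H0 *m Y *m _) in Ebz.
have colz (A : 'M[ratfun K]_n) a b : col j (map_mx (leval z) A) a b = leval z (A a j).
  by rewrite !mxE.
(* Columns j of b' and of g(w), evaluated at z, vanish on the gap rows and agree on row
   [gap_pred j]; these k rows carry the nonzero minor P_{[j-k,j-1]} of w. *)
have XY' : col j X = col j Y'.
  apply: (@minor_neq0_eq _ _ _ (gapset k j (gap_pred k_range j)) (grmx w.1)).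
    exact: (pdom_gmap k_range w).1.
  move=> a b; rewrite mem_gapset // -!col_mulmx -Ebz -EY' !colz b_val leval_gmap //.
  case/orP => [/eqP ->|g]; first by rewrite beta_bottom gcoef_bottom.
  by rewrite beta_gap // gcoef_gap.
have : col j (map_mx (leval z) b') = col j (map_mx (leval z) (gmap w)).
  by rewrite Ebz EY' (col_mulmx _ X) (col_mulmx _ Y') XY'.
by move/colP/(_ i); rewrite !colz.
Qed.

(** Both u and its inverse have Laurent polynomial entries, so u is invertible at every nonzero
    value of lambda, and U acts everywhere. *)
Lemma Uact_unit u v : inU u -> pdom (Uact u) v.
Proof.
by move=> /(inU_unipotent n_ge2) Uu; apply: unipotent_leval => //; exact: lambda_val_neq0.
Qed.

Lemma gr_act_mul (A B : 'M[K]_n) (W : grass K n k) : A \in unitmx -> B \in unitmx ->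
  gr_act (A *m B) W = gr_act A (gr_act B W).
Proof.
move=> uA uB; apply: (@spans_uniq _ _ _ (A *m B *m grmx W)).
  by apply: spans_act; [rewrite unitmx_mul uA | exact: spans_grmx].
by rewrite -mulmxA; do 2!apply: spans_act => //; exact: spans_grmx.
Qed.

Lemma gr_act1 (W : grass K n k) : gr_act 1%:M W = W.
Proof.
apply: (@spans_uniq _ _ _ (1%:M *m grmx W)); first by apply: spans_act; rewrite ?unitmx1 //; exact: spans_grmx.
by rewrite mul1mx; exact: spans_grmx.
Qed.

Lemma leval_xhat (z : K) i a : z != 0 ->
  map_mx (leval z) (xhat i a) = xmx i (if val i == 0%N then a / z else a).
Proof.
move=> z0; apply/matrixP => r s; rewrite /xhat /xmx !mxE levalD //.
- congr (_ + _); first by case: (r == s); rewrite ?leval1 ?leval0.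
  case: ifP => _; rewrite !mxE; case: (_ && _); rewrite ?mulr1 ?mulr0 ?leval0 //.
    exact: leval_scal_lambda.
  exact: leval_scal.
- by case: (r == s); [exact: laurent1 | exact: laurent0].
- case: ifP => _; rewrite !mxE; case: (_ && _); rewrite ?mulr1 ?mulr0.
  + by rewrite -[scal a / _]/(lfrac (a%:P, 1%N)); eexists.
  + exact: laurent0.
  + exact: laurent_scal.
  + exact: laurent0.
Qed.

Lemma Gm_chart_poly (c : chart (Gm K)) : chart_poly c (fun t : Gm K => val t).
Proof.
apply: (eq_chart_poly _ (chart_poly_coord (i := c) (lshift 1 ord0))) => t _.
by rewrite /coord /= row_mxEl mxE eqxx mulr1n.
Qed.

Lemma Gm_chart_polyV (c : chart (Gm K)) : chart_poly c (fun t : Gm K => (val t)^-1).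
Proof.
apply: (eq_chart_poly _ (chart_poly_coord (i := c) (rshift 1 ord0))) => t _.
by rewrite /coord /= row_mxEr mxE eqxx mulr1n.
Qed.

Lemma line_chart_poly (c : chart (affine_line K)) :
  chart_poly c (fun a : affine_line K => a).
Proof.
apply: (eq_chart_poly _ (chart_poly_coord (i := c) ord0)) => t _.
by rewrite /coord /= mxE eqxx mulr1n.
Qed.

Lemma Xk_chart_poly_nmx (c : chart Xk) : fa_mx (chart_poly c) (fun v : Xk => nmx c.1 v.1).
Proof.
move=> a b; apply: (chart_poly_fst (i := c) (h := fun W => nmx c.1 W a b)).
exact: chart_poly_nmx.
Qed.

Lemma Uact_xhat_regular i (x : prodV (affine_line K) Xk) :
  regular_at (fun av : prodV (affine_line K) Xk => pdom (Uact (xhat i av.1)) av.2)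
    (fun av => Uact (xhat i av.1) av.2) x.
Proof.
case: x => a0 v0; have [J mJ] := grmx_minor v0.1.
have [J' mJ'] := grmx_minor (Uact (xhat i a0) v0).1.
pose c : chart (prodV (affine_line K) Xk) := (tt, (J, tt)).
pose d : chart Xk := (J', tt).
(* For i = 0 this is a / lambda at lambda = (-1)^(k-1) t; it is polynomial because the inverse of t
   is itself a coordinate on K^*. *)
pose B (y : prodV (affine_line K) Xk) : K :=
  if val i == 0%N then (-1) ^+ k.-1 * ((val y.2.2)^-1 * y.1) else y.1.
pose M (y : prodV (affine_line K) Xk) := xmx i (B y) *m nmx J y.2.1.
have fc := funalg_chart_poly c.
have Bpoly : chart_poly c B.
  have ya : chart_poly c (fun y => y.1).
    exact: (chart_poly_fst (i := c) (line_chart_poly tt)).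
  rewrite /B; case: (val i == 0%N) => //; apply: fa_mul => //; first exact: fa_cst.
  apply: fa_mul => //.
  apply: (chart_poly_snd (i := c) (h := fun v : Xk => (val v.2)^-1)).
  exact: (chart_poly_snd (i := c.2) (Gm_chart_polyV tt)).
have Npoly : fa_mx (chart_poly c) (fun y => nmx J y.2.1).
  move=> a b; apply: (chart_poly_snd (i := c) (h := fun v : Xk => nmx J v.1 a b)).
  exact: (@Xk_chart_poly_nmx (J, tt)).
have Mpoly : fa_mx (chart_poly c) M.
  apply: fa_mulmx => // a b; rewrite /xmx.
  pose e := (if val i == 0%N then Emx n K n 1 else Emx n K i i.+1) a b.
  have -> : (fun y => (1%:M + (if val i == 0%N then B y *: Emx n K n 1 else B y *: Emx n K i i.+1)) a b)
     = (fun y => (1%:M : 'M[K]_n) a b + B y * e).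
    by apply/funext => y; rewrite /e mxE; case: ifP => _; congr (_ + _); rewrite mxE.
  by apply: fa_add => //; [exact: fa_cst | apply: fa_mul => //; exact: fa_cst].
have Ux (y : prodV (affine_line K) Xk) : pdom (Uact (xhat i y.1)) y.2.
  by apply: Uact_unit; exact: inU_gen.
have evE (y : prodV (affine_line K) Xk) :
    map_mx (leval (lambda_val y.2)) (xhat i y.1) = xmx i (B y).
  rewrite leval_xhat ?lambda_val_neq0 //; congr xmx; rewrite /B /lambda_val.
  by case: ifP => // _; rewrite invfM invr_sign mulrC -mulrA.
have sM (y : prodV (affine_line K) Xk) : minor J (grmx y.2.1) != 0 ->
    spans (M y) (Uact (xhat i y.1) y.2).1.
  move=> my; have uy := Ux y; rewrite /M -evE.
  by apply: spans_act => //; exact: nmx_spans.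
pose q y := minor J' (M y).
have qpoly : chart_poly c q by exact: fa_minor.
have Apoly : fa_mx (chart_poly c) (fun y => M y *m \adj (rows J' (M y))).
  by apply: fa_mulmx => //; apply: fa_adj => //; exact: fa_rows.
(* The coordinates of t are multiplied by q, so that all components have the denominator q of
   Cramer's rule. *)
pose h (l : 'I_(cdim d)) (y : prodV (affine_line K) Xk) : K :=
  match split (l : 'I_(n * k + (1 + 1))) with
  | inl l' => mxvec (M y *m \adj (rows J' (M y))) ord0 l'
  | inr l' => coord (c := Gm K) tt y.2.2 ord0 l' * q y
  end.
apply: (regular_atP (i := c) (j := d) (h := h) (q := q)) => //.
- rewrite /h => l; case: (split _) => l'.
    case/mxvec_indexP: l' => a b.
    by apply: eq_chart_poly (Apoly a b) => y _; rewrite mxvecE.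
  apply: fa_mul => //.
  apply: (chart_poly_snd (i := c) (h := fun v : Xk => coord (c := Gm K) tt v.2 ord0 l')).
  apply: (chart_poly_snd (i := c.2) (h := fun t : Gm K => coord (c := Gm K) tt t ord0 l')).
  exact: chart_poly_coord.
- by rewrite /q -(spans_minor_neq0 _ (sM (a0, v0) mJ)).
- move=> y [_ [my _]] qy; split=> //.
    by split=> //; have := qy; rewrite /q -(spans_minor_neq0 _ (sM y my)).
  move=> l; rewrite /h mxE; case: splitP => l' _; last by rewrite mulfK.
  case/mxvec_indexP: l' => a b; rewrite mxvecE -/(nmx J' _) (nmx_adj (sM y my) qy).
  by rewrite mxE mxvecE mulrC.
Qed.

Lemma Uact_pseudo_rational : pseudo_rational Uact.
Proof.
split.
- move=> v; have E := @leval_1mx K n _ (lambda_val_neq0 v); rewrite /lambda_val in E.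
  by rewrite /= E unitmx1 gr_act1; split=> //; case: v E.
- move=> u u' v Uu Uu' _ _; split.
    by apply: Uact_unit; exact: inU_mul.
  have z0 := lambda_val_neq0 v; have du := Uact_unit v Uu; have du' := Uact_unit v Uu'.
  have lu := unipotent_laurent (inU_unipotent n_ge2 Uu).
  have lu' := unipotent_laurent (inU_unipotent n_ge2 Uu').
  have := leval_mulmx z0 lu' lu; rewrite /lambda_val => E.
  by rewrite /= E gr_act_mul.
- move=> i; split; last by move=> x _; exact: Uact_xhat_regular.
  move=> O _ [x Ox]; exists x; split=> //=.
  by apply: Uact_unit; exact: inU_gen.
Qed.

End Equivariance.

(** * The unipotent crystal and its induced geometric crystal *)

Section InducedCrystal.
Variables (K : fieldType) (n k : nat).
Hypotheses (charK : [pchar K] =i pred0) (k_range : (0 < k < n)%N).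
Local Notation Xk := (Xk K n k).
Local Notation GmXk := (prodV (Gm K) Xk).
Local Notation gmap := (@gmap K n k).
Local Notation Uact := (@Uact K n k).
Local Notation gcoef := (@gcoef K n k k_range).
Local Notation gap_pred := (gap_pred k_range).
Implicit Types (i j : 'I_n) (v : Xk) (r : seq {set 'I_n}).

Let le_kn : (k <= n)%N. Proof. by lia. Qed.

Definition nonzero_minors r : set Xk :=
  [set v | all (fun J => minor J (grmx v.1) != 0) r].

Lemma chart_poly_minors (c : chart Xk) r :
  chart_poly c (fun v : Xk => \prod_(J <- r) minor J (nmx c.1 v.1)).
Proof.
have fc := funalg_chart_poly c; apply: fa_prod => // J _; apply: fa_minor => //.
exact: Xk_chart_poly_nmx.
Qed.

Lemma nonzero_minors_chart (c : chart Xk) r v : cdom c v ->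
  (nonzero_minors r v <-> \prod_(J <- r) minor J (nmx c.1 v.1) != 0).
Proof.
move=> [mc _]; rewrite prodf_seq_neq0 /nonzero_minors /=.
by rewrite (eq_all (a2 := fun J => true ==> (minor J (nmx c.1 v.1) != 0))) // => J;
  rewrite (spans_minor_neq0 _ (nmx_spans mc)).
Qed.

Lemma zopen_nonzero_minors r : zopen (nonzero_minors r).
Proof.
apply: zopen_nonzero => c; eexists; first exact: (chart_poly_minors c r).
by move=> v; exact: nonzero_minors_chart.
Qed.

Lemma zopen_nonzero_minors_Gm r : zopen ([set cv | nonzero_minors r cv.2] : set GmXk).
Proof.
apply: zopen_nonzero => c; eexists.
  exact: (chart_poly_snd (i := c) (chart_poly_minors c.2 r)).
by move=> v [_ vc]; exact: nonzero_minors_chart.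
Qed.

Lemma nonzero_minors_generic :
  exists v : Xk, forall r, {in r, forall J : {set 'I_n}, #|J| = k} -> nonzero_minors r v.
Proof.
have [W mW] := generic_point charK le_kn.
exists (W, exist (fun c : K => c != 0) 1 (oner_neq0 K)) => r cr.
by apply/allP => J /cr; exact: mW.
Qed.

(** By irreducibility it suffices that this open set be nonempty, and it contains the generic
    point. *)
Lemma zdense_nonzero_minors r : {in r, forall J : {set 'I_n}, #|J| = k} -> zdense (nonzero_minors r).
Proof.
move=> cr; apply: irreducible_zdense; first exact: irreducible_Xk.
  exact: zopen_nonzero_minors.
by have [v Hv] := nonzero_minors_generic; exists v; exact: Hv.
Qed.

Lemma eq_rational_minors (T : Type) (f h : pmap Xk T) r :
  {in r, forall J : {set 'I_n}, #|J| = k} ->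
  (forall v, pdom f v /\ pdom h v <-> nonzero_minors r v) ->
  (forall v, pdom f v -> pdom h v -> f v = h v) -> eq_rational f h.
Proof.
move=> cr E fh.
have -> // : eq_rational f h = [/\ zopen (nonzero_minors r), zdense (nonzero_minors r) &
   forall v, pdom f v -> pdom h v -> f v = h v].
  rewrite /eq_rational; suff -> : pdom f `&` pdom h = nonzero_minors r by [].
  by apply/seteqP; split=> v /E.
by split=> //; [exact: zopen_nonzero_minors | exact: zdense_nonzero_minors].
Qed.

Lemma eq_rational_minors_Gm (T : Type) (f h : pmap GmXk T) r :
  {in r, forall J : {set 'I_n}, #|J| = k} ->
  (forall cv, pdom f cv /\ pdom h cv <-> nonzero_minors r cv.2) ->
  (forall cv, pdom f cv -> pdom h cv -> f cv = h cv) -> eq_rational f h.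
Proof.
move=> cr E fh.
have EO : pdom f `&` pdom h = [set cv | nonzero_minors r cv.2].
  by apply/seteqP; split=> cv /E.
split; rewrite ?EO //; first exact: zopen_nonzero_minors_Gm.
apply: irreducible_zdense; first exact: irreducible_Gm_Xk.
  exact: zopen_nonzero_minors_Gm.
have [v Hv] := nonzero_minors_generic.
by exists (v.2, v); exact: Hv.
Qed.

Definition cyclic_sets : seq {set 'I_n} := [seq gapset k j (gap_pred j) | j <- enum 'I_n].

Lemma pdom_gmap_minors v : pdom gmap v <-> nonzero_minors cyclic_sets v.
Proof.
rewrite (pdom_gmap k_range); split=> [H|/allP H j].
  by apply/allP => J /mapP[j _ ->]; exact: H.
by apply: H; apply/mapP; exists j; rewrite ?mem_enum.
Qed.

(** As k < n, the rows [i-k+1, i-1] do not reach i+1 modulo n. So the numerator of phi_i is a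
    genuine k x k minor, nonzero at the generic point. *)
Lemma gap_ord_pred i : ~~ gap k (ord_pred i) i.
Proof.
have E := val_ord_pred i; rewrite /gap E; have := ltn_ord i; have := k_range.
by case: eqP => ?; lia.
Qed.

Lemma gap_gap_pred j : ~~ gap k j (gap_pred j).
Proof. by rewrite /gap /=; have := ltn_ord j; have := k_range; case: ifP; lia. Qed.

Lemma card_gapset j i : ~~ gap k j i -> #|gapset k j i| = k.
Proof.
move=> ngi; have k0 : (0 < k)%N by lia.
have -> : gapset k j i = i |: (gap_row k_range j @: 'I_k.-1)%SET.
  apply/finset.setP => a; rewrite mem_gapset // in_setU1; congr (_ || _).
  apply/idP/imsetP => [/(gap_rowP k_range)[b <-]|[b _ ->]]; first by exists b.
  by apply/(gap_rowP k_range); exists b.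
rewrite cardsU1 card_imset; last exact: gap_row_inj.
rewrite card_ord; suff -> : i \notin (gap_row k_range j @: 'I_k.-1)%SET by rewrite /=; lia.
apply: contra ngi => /imsetP[b _ ->]; by apply/(gap_rowP k_range); exists b.
Qed.

Lemma card_cyclic_sets : {in cyclic_sets, forall J : {set 'I_n}, #|J| = k}.
Proof. by move=> J /mapP[j _ ->]; apply: card_gapset; exact: gap_gap_pred. Qed.

Lemma gmap_rational : rational_Bminus gmap.
Proof.
split.
- exact: gmap_Bminus.
- exists 1%N => v _ i j m lt_m; rewrite (lcoef_gmap k_range) ifF //.
  by apply/eqP => Em; move: lt_m; rewrite Em; case: ltnP.
move=> i j m; split.
  have := zdense_nonzero_minors card_cyclic_sets.
  by suff -> : nonzero_minors cyclic_sets = pdom gmap by []; apply/seteqP; split=> v /pdom_gmap_minors.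
move=> v dv; have [J mJ] := grmx_minor v.1.
pose c : chart Xk := (J, tt); have vc : cdom c v by [].
have fc := funalg_chart_poly c.
(* The product runs over all cyclic minors, not just the denominator of column j, so that q(y)
   nonzero puts y in the domain of g; the numerator h is multiplied by the other factors. *)
pose q (y : Xk) := \prod_(I <- cyclic_sets) minor I (nmx J y.1).
pose s (y : Xk) : K := if (k <= j)%N && (j <= i)%N then val y.2 else 1.
pose h (l : 'I_1) (y : Xk) : K := if m == (i < j)%N%:Z then
  s y * minor (gapset k j i) (nmx J y.1) *
  \prod_(j' <- rem j (enum 'I_n)) minor (gapset k j' (gap_pred j')) (nmx J y.1) else 0.
have Npoly : fa_mx (chart_poly c) (fun y : Xk => nmx J y.1) by exact: Xk_chart_poly_nmx.
apply: (@regular_atP _ _ (affine_line K) _ _ _ c tt h q).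
- move=> l; rewrite /h; case: eqP => _; last exact: fa_cst.
  apply: fa_mul => //; last by apply: fa_prod => // j' _; exact: fa_minor.
  apply: fa_mul => //; last exact: fa_minor.
  rewrite /s; case: (_ && _); last exact: fa_cst.
  exact: (chart_poly_snd (i := c) (Gm_chart_poly tt)).
- exact: (chart_poly_minors c cyclic_sets).
- by [].
- by apply/(nonzero_minors_chart _ vc)/pdom_gmap_minors.
- move=> y yc qy; have dy : pdom gmap y.
    by apply/pdom_gmap_minors/(nonzero_minors_chart _ yc).
  split=> // l; transitivity (lcoef (gmap y i j) m).
    by rewrite [LHS]mxE (ord1 l) eqxx mulr1n.
  rewrite /h (lcoef_gmap k_range).
  case: eqP => _; last by rewrite mul0r.
  have [my _] := yc; have [a a0 Ea] := spans_minor (nmx_spans my).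
  have qE : q y = minor (gapset k j (gap_pred j)) (nmx J y.1) *
      \prod_(j' <- rem j (enum 'I_n)) minor (gapset k j' (gap_pred j')) (nmx J y.1).
    by rewrite /q big_map (big_rem j) ?mem_enum.
  have : q y != 0 by [].
  rewrite qE mulf_eq0 negb_or => /andP[q1 q2].
  rewrite /gcoef /cminor !Ea -/(s y) -[RHS]mulf_div divff // mulr1 -[RHS]mulrA.
  by rewrite -mulf_div divff // mulr1.
Qed.

(** Both entries lie in the same column, so the denominators cancel. The factors t cancel as well
    except for i = 0, that is in column n, where the diagonal entry has a factor t and the entry of
    row 1 has lambda instead. *)
Lemma induced_phiE i v : pdom gmap v -> induced_phi gmap i v = gr_phi i v.
Proof.
move=> dv; rewrite /induced_phi (unfolding_gmap_next k_range) (unfolding_gmap_prev k_range).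
rewrite /gr_phi /pluck (gapset_next k_range) (residues_gapset_pred k_range) -(gapset_diag k_range).
rewrite -/(cminor v _ _) -/(cminor v _ _) /gcoef.
have d0 := (pdom_gmap k_range v).1 dv (ord_pred i).
have := cminor_diag k_range (ord_pred i) dv; set D := cminor v (ord_pred i) (gap_pred _) in d0 *.
set A := cminor v _ i; set B := cminor v _ (ord_pred i) => B0.
have t0 : val v.2 != 0 by exact: (valP v.2).
have R : (A / D) / (B / D) = A / B by rewrite invf_div mulrA mulfVK.
have E := val_ord_pred i; have i_n := ltn_ord i; rewrite -mulf_div R; congr (_ * _).
rewrite leqnn andbT E; case: (eqVneq (i : nat) 0%N) => i0.
  by rewrite ifF 1?ifT ?div1r //; lia.
have -> : (i.-1 <= i)%N by lia.
by rewrite andbT divff //; case: ifP; rewrite ?oner_eq0.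
Qed.

(** The entries lie in columns i and i+1, whose factors t differ exactly for i = k. For i = 0
    neither has one: the entry in column n has lambda instead, and k >= 1 excludes t from column
    1. *)
Lemma induced_epsE i v : pdom gmap v ->
  unfolding (gmap v) (i%:Z + 1) i / unfolding (gmap v) (i%:Z + 1) (i%:Z + 1) = gr_eps i v.
Proof.
have Ei : i%:Z + 1 = i.+1%:Z by lia.
move=> dv; rewrite (unfolding_gmap_next k_range) (unfolding_gmap_diag k_range v Ei).
rewrite /gr_eps /pluck (gapset_next k_range) (residues_gapset_pred k_range) (residues_ord_pred k_range).
have -> : zint (i%:Z - k%:Z + 2) (i%:Z + 1) = zint (i.+1%:Z - k%:Z + 1) i.+1%:Z.
  by congr zint; lia.
rewrite (residues_gapset_diag k_range (erefl _)) -!/(cminor v _ _) /gcoef.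
have dj := (pdom_gmap k_range v).1 dv (ord_pred i).
have di := (pdom_gmap k_range v).1 dv i.
have := cminor_diag k_range i dv; set B := cminor v i i => B0.
set A := cminor v _ i; set Dj := cminor v (ord_pred i) _ in dj *; set Di := cminor v i _ in di *.
have t0 : val v.2 != 0 by exact: (valP v.2).
have R : (A / Dj) / (B / Di) = A * Di / (Dj * B) by rewrite invf_div mulf_div.
have E := val_ord_pred i; have i_n := ltn_ord i; rewrite -mulf_div R; congr (_ * _).
rewrite leqnn andbT E; case: (eqVneq (i : nat) 0%N) => i0.
  by rewrite !ifF ?divr1 //; lia.
have -> : (i.-1 <= i)%N by lia.
rewrite andbT; case: (ltngtP i k) => ik.
- by rewrite !ifF ?divr1 //; lia.
- by rewrite !ifT ?divff //; lia.
- by rewrite ifF ?ifT ?div1r //; lia.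
Qed.

Lemma gr_phi_neq0 i v : pdom gmap v -> (gr_phi i v != 0) = (cminor v (ord_pred i) i != 0).
Proof.
move=> dv; rewrite /gr_phi /pluck (gapset_next k_range) (residues_gapset_pred k_range) -!/(cminor v _ _).
rewrite !mulf_eq0 invr_eq0 (negPf ((pdom_gmap k_range v).1 dv i)) orbF.
by case: ifP => _; rewrite ?invr_eq0 ?oner_eq0 // (negPf (valP v.2)).
Qed.

Lemma gmap_crystal : unipotent_crystal Uact gmap.
Proof.
split.
- by split; [exact: variety_Xk | exact: irreducible_Xk].
- exact: Uact_pseudo_rational.
- exact: gmap_rational.
- by move=> u v b' Uu _; exact: gmap_equivariant.
- move=> i; have [v Hv] := nonzero_minors_generic.
  have dv : pdom gmap v by apply/pdom_gmap_minors/Hv/card_cyclic_sets.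
  exists v => //; rewrite (unfolding_gmap_next k_range) /gcoef !mulf_neq0 //.
  + by case: ifP => _; rewrite ?oner_eq0 //; exact: (valP v.2).
  + have := Hv [:: gapset k (ord_pred i) i]; rewrite /nonzero_minors /= andbT; apply.
    by move=> J; rewrite inE => /eqP ->; apply: card_gapset; exact: gap_ord_pred.
  + by rewrite invr_eq0; exact: (pdom_gmap k_range v).1.
Qed.

Lemma gmap_induced_crystal : eq_crystal (induced_crystal Uact gmap) (@gr_crystal K n k).
Proof.
split.
- apply: (eq_rational_minors card_cyclic_sets) => v.
    by rewrite -pdom_gmap_minors; split=> [[]|].
  move=> dv _; apply/rowP => j; rewrite !mxE (unfolding_gmap_diag k_range v (erefl _)).
  rewrite /gr_gamma /pluck (residues_gapset_diag k_range (erefl _)) -gapset_pred -!/(cminor v _ _).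
  by rewrite /gcoef leqnn andbT ltnNge; case: (leqP k j).
- move=> i; apply: (eq_rational_minors card_cyclic_sets) => v /=.
    rewrite -pdom_gmap_minors; split=> [[]//|dv]; split=> //.
    by rewrite /pluck (residues_gapset_pred k_range); exact: (pdom_gmap k_range v).1.
  by move=> dv _; exact: induced_phiE.
- move=> i; apply: (eq_rational_minors card_cyclic_sets) => v /=.
    rewrite -pdom_gmap_minors; split=> [[]//|dv]; split=> //; split.
      by rewrite /pluck (residues_ord_pred k_range); exact: (pdom_gmap k_range v).1.
    have -> : zint (i%:Z - k%:Z + 2) (i%:Z + 1) = zint (i.+1%:Z - k%:Z + 1) i.+1%:Z.
      by congr zint; lia.
    by rewrite /pluck (residues_gapset_diag k_range (erefl _)); exact: (cminor_diag k_range i dv).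
  by move=> dv _; exact: induced_epsE.
(* Besides the cyclic minors, the numerator of phi_i has to be nonzero for e_i to be defined. *)
- move=> i; apply: (eq_rational_minors_Gm (r := gapset k (ord_pred i) i :: cyclic_sets)).
  + move=> J; rewrite inE => /orP[/eqP ->|]; last exact: card_cyclic_sets.
    by apply: card_gapset; exact: gap_ord_pred.
  + move=> [c v]; rewrite /nonzero_minors /=; split.
      move=> [[dv _ _] [_ phi0]]; apply/andP; split; last exact/pdom_gmap_minors.
      by rewrite -/(cminor v _ _) -gr_phi_neq0.
    move=> /andP[A0 /pdom_gmap_minors dv].
    have phi0 : gr_phi i v != 0 by rewrite gr_phi_neq0.
    split; [split=> // | split=> //].
    * by rewrite induced_phiE.
    * by apply: (Uact_unit k_range); exact: inU_gen.
    * by rewrite /pluck (residues_gapset_pred k_range); exact: (pdom_gmap k_range v).1.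
  + move=> [c v] [/= dv _ _] _; rewrite induced_phiE //; congr (_, _).
    (* The factor (-1)^(k-1) / t in e_0 is the value of 1 / lambda at lambda = (-1)^(k-1) t. *)
    have z0 := lambda_val_neq0 v.
    rewrite -/(lambda_val v) (leval_xhat _ _ z0); congr (gr_act (xmx _ _) _).
    case: ifP => // _; rewrite [RHS]mulrC; congr (_ * _).
    by rewrite /lambda_val invfM invr_sign.
Qed.

End InducedCrystal.

Theorem theorem6p10 (R : realType) (n k : nat)
    (n_ge2 : (2 <= n)%N) (k_range : (1 <= k <= n - 1)%N) :
  unipotent_crystal (@Uact R[i] n k) (@gmap R[i] n k) /\
  eq_crystal (induced_crystal (@Uact R[i] n k) (@gmap R[i] n k))
             (@gr_crystal R[i] n k).
Proof.
have kn : (0 < k < n)%N by lia.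
have charC : [pchar R[i]] =i pred0 by exact: pchar_num.
by split; [exact: gmap_crystal | exact: gmap_induced_crystal].
Qed.
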